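(* Let $F=f+\psi$ on $\mathbb{R}^d$, where $f:\mathbb{R}^d\to\mathbb{R}$ is convex and three times differentiable with $M$-Lipschitz continuous Hessian, $\psi:\mathbb{R}^d\to\mathbb{R}\cup\{+\infty\}$ is proper, closed and convex, and $F$ has a minimizer $x^*$; put $F^*=F(x^* )$. Suppose that $\nabla^2 f(x)\preceq L\,\mathbf{I}^d$ for all $x\in\mathbb{R}^d$, that the distribution $\mathcal{D}$ of random matrices satisfies $\mathbb{E}[\mathbf{P}^{\mathbf{S}}]=\frac{\tau}{d}\mathbf{I}^d$ for some $\tau>0$, and that $\psi$ is $\mathrm{Range}(\mathcal{D})$-separable. Let $\{x^k\}_{k\ge 0}$ be generated by SSCN from $x^0$. Denote $$R := \sup_{x\in\mathbb{R}^d}\left\{\|x-x^*\| \;:\; F(x)\le F(x^0)\right\}$$ and suppose that $R<+\infty$. Then for every $k\ge 1$, $$\mathbb{E}[F(x^k)]-F^* \;\le\; \frac{d-\tau}{\tau}\cdot\frac{4.5\,L R^2}{k}+\left(\frac{d}{\tau}\right)^2\cdot\frac{9\,M R^3}{k^2}+\frac{F(x^0)-F^*}{1+\frac14\left(\frac{\tau}{d}k\right)^3}.$$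
   Context: $\|\cdot\|$ is the Euclidean norm and $\mathbf{I}^q$ the $q\times q$ identity. Distribution: $\mathcal{D}$ is a fixed distribution of random matrices $\mathbf{S}\in\mathbb{R}^{d\times\tau(\mathbf{S})}$ (the number of columns $\tau(\mathbf{S})$ may be random) having full column rank with probability one. $\mathbf{P}^{\mathbf{S}}:=\mathbf{S}(\mathbf{S}^\top\mathbf{S})^{-1}\mathbf{S}^\top$ is the orthogonal projection onto the range of $\mathbf{S}$. $\mathrm{Range}(\mathcal{D})$ denotes the set of matrices that $\mathcal{D}$ takes as values. Subspace quantities: $\nabla_{\mathbf{S}}f(x):=\mathbf{S}^\top\nabla f(x)$, $\nabla^2_{\mathbf{S}}f(x):=\mathbf{S}^\top\nabla^2 f(x)\mathbf{S}$, and $$M_{\mathbf{S}}:=\max_{x\in\mathbb{R}^d}\max_{h\in\mathbb{R}^{\tau(\mathbf{S})},\,h\ne0}\frac{|\nabla^3 f(x)[\mathbf{S}h]^3|}{\|\mathbf{S}h\|^3}.$$ Algorithm SSCN (Stochastic Subspace Cubic Newton): start from $x^0$; for $k=0,1,\dots$ sample $\mathbf{S}\sim\mathcal{D}$ independently of the past, let $h^k=\arg\min_{h\in\mathbb{R}^{\tau(\mathbf{S})}}T_{\mathbf{S}}(x^k,h)$, where $$T_{\mathbf{S}}(x,h):=\langle\nabla_{\mathbf{S}}f(x),h\rangle+\tfrac12\langle\nabla^2_{\mathbf{S}}f(x)h,h\rangle+\tfrac{M_{\mathbf{S}}}{6}\|\mathbf{S}h\|^3+\psi(x+\mathbf{S}h),$$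 and set $x^{k+1}=x^k+\mathbf{S}h^k$. Separability: for a set $D$ of full-column-rank matrices with $d$ rows, a set $Q\subseteq\mathbb{R}^d$ is $D$-separable if $\mathbf{P}^{\mathbf{S}}x+(\mathbf{I}^d-\mathbf{P}^{\mathbf{S}})y\in Q$ for all $x,y\in Q$ and $\mathbf{S}\in D$. A function $\phi:\mathbb{R}^d\to\mathbb{R}\cup\{+\infty\}$ is $D$-separable if $\mathrm{dom}\,\phi$ is $D$-separable and there is a map $\phi':\mathrm{dom}\,\phi\to\mathbb{R}^d$ such that (1) $\phi(x)=\langle\phi'(x),e\rangle$ for all $x\in\mathrm{dom}\,\phi$, where $e$ is the all-ones vector, and (2) $\phi'(\mathbf{P}^{\mathbf{S}}x+(\mathbf{I}^d-\mathbf{P}^{\mathbf{S}})y)=\mathbf{P}^{\mathbf{S}}\phi'(x)+(\mathbf{I}^d-\mathbf{P}^{\mathbf{S}})\phi'(y)$ for all $x,y\in\mathrm{dom}\,\phi$, $\mathbf{S}\in D$. *)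

(* Defs.v *)
From HB Require Import structures.
From mathcomp Require Import all_boot all_order all_algebra.
From mathcomp Require Import all_classical all_reals all_analysis.

Set Implicit Arguments.
Unset Strict Implicit.
Unset Printing Implicit Defensive.

Import Order.TTheory GRing.Theory Num.Theory.
Import numFieldNormedType.Exports.

Local Open Scope classical_set_scope.
Local Open Scope ring_scope.

Section Euclidean.
Variables (R : realType).

Definition dot n (u v : 'cV[R]_n) : R := (u^T *m v) 0 0.

(* The canonical norm of the library on matrices is the max norm; it is used
   below only for topology and differentiability. *)
Definition enorm n (u : 'cV[R]_n) : R := Num.sqrt (dot u u).

Definition opnorm m n (A : 'M[R]_(m, n)) : R :=
  sup [set enorm (A *m h) | h in [set h : 'cV[R]_n | enorm h <= 1]].

Definition loewner_le n (A B : 'M[R]_n) : Prop :=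
  forall h : 'cV[R]_n, 0 <= dot ((B - A) *m h) h.

End Euclidean.

Section Derivatives.
Variables (R : realType) (d : nat).
Implicit Types (f : 'cV[R]_d -> R) (x h : 'cV[R]_d).

Definition grad f x : 'cV[R]_d := \col_i 'D_(delta_mx i 0) f x.

Definition hess f x : 'M[R]_d :=
  \matrix_(i, j) 'D_(delta_mx j 0) (fun y => grad f y i 0) x.

(* The third derivative evaluated at (h, h, h). *)
Definition deriv3 f x h : R := 'D_h (fun y => 'D_h (fun z => 'D_h f z) y) x.

(* Fréchet differentiability of f and of its first two derivatives. *)
Definition three_times_differentiable f : Prop :=
  [/\ forall x, differentiable f x,
      forall x, differentiable (grad f) x
    & forall x, differentiable (hess f) x].

Definition lipschitz_hessian f (M : R) : Prop :=
  forall x y, opnorm (hess f x - hess f y) <= M * enorm (x - y).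

End Derivatives.

Section ExtendedValued.
Variables (R : realType) (d : nat).
Implicit Types (psi : 'cV[R]_d -> \bar R).
Local Open Scope ereal_scope.

Definition edom psi : set 'cV[R]_d := [set x | psi x < +oo].

Definition proper_fun psi : Prop := (forall x, -oo < psi x) /\ edom psi !=set0.

Definition closed_fun psi : Prop :=
  closed [set p : 'cV[R]_d * R | psi p.1 <= p.2%:E].

(* At t = 0 and t = 1 this relies on the convention 0 * +oo = 0. *)
Definition econvex psi : Prop :=
  forall (t : R) (x y : 'cV[R]_d), (0 <= t <= 1)%R ->
    psi (t *: x + (1 - t) *: y)%R <= t%:E * psi x + (1 - t)%:E * psi y.

Definition objective (f : 'cV[R]_d -> R) psi (y : 'cV[R]_d) : \bar R :=
  (f y)%:E + psi y.

Definition level_radius (F : 'cV[R]_d -> \bar R) (xs x0 : 'cV[R]_d) : \bar R :=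
  ereal_sup [set (enorm (y - xs)%R)%:E | y in [set y | F y <= F x0]].

End ExtendedValued.

(* Matrices with d rows and an arbitrary number of columns, with the topology
   of the disjoint union over the number of columns. *)
Definition sketch (R : realType) (d : nat) : Type := {n : nat & 'M[R]_(d, n)}.

HB.instance Definition _ (R : realType) (d : nat) :=
  Topological.copy (sketch R d) {n : nat & 'M[R]_(d, n)}.
HB.instance Definition _ (R : realType) (d : nat) :=
  isPointed.Build (sketch R d) (existT (fun n => 'M[R]_(d, n)) 0%N 0).

Definition borelType (T : ptopologicalType) := g_sigma_algebraType (@open T).
HB.instance Definition _ (T : ptopologicalType) :=
  Measurable.copy (borelType T) (g_sigma_algebraType (@open T)).

Section Sketches.
Variables (R : realType) (d : nat).

Definition ncols (S : sketch R d) : nat := projT1 S.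

Definition mat (S : sketch R d) : 'M[R]_(d, ncols S) := projT2 S.

Definition full_column_rank : set (sketch R d) :=
  [set S | \rank (mat S) = ncols S].

(* Meaningful when S has full column rank; otherwise invmx is the identity. *)
Definition projS (S : sketch R d) : 'M[R]_d :=
  mat S *m invmx ((mat S)^T *m mat S) *m (mat S)^T.

Definition separable_set (Dm : set (sketch R d)) (Q : set 'cV[R]_d) : Prop :=
  forall x y S, Q x -> Q y -> Dm S ->
    Q (projS S *m x + (1%:M - projS S) *m y).

Definition separable_fun (Dm : set (sketch R d)) (phi : 'cV[R]_d -> \bar R) : Prop :=
  separable_set Dm (edom phi) /\
  exists phi' : 'cV[R]_d -> 'cV[R]_d,
    (forall x, edom phi x -> phi x = (dot (phi' x) (const_mx 1))%:E) /\
    (forall x y S, edom phi x -> edom phi y -> Dm S ->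
       phi' (projS S *m x + (1%:M - projS S) *m y) =
       projS S *m phi' x + (1%:M - projS S) *m phi' y).

End Sketches.

Section SSCN.
Variables (R : realType) (d : nat).
Variables (f : 'cV[R]_d -> R) (psi : 'cV[R]_d -> \bar R).
Implicit Types (S : sketch R d) (x : 'cV[R]_d).

Definition gradS S x : 'cV[R]_(ncols S) := (mat S)^T *m grad f x.

Definition hessS S x : 'M[R]_(ncols S) := (mat S)^T *m hess f x *m mat S.

(* The maximum over x and h is read as a supremum; it need not be attained. *)
Definition MS S : R :=
  sup [set `|deriv3 f x (mat S *m h)| / enorm (mat S *m h) ^+ 3
      | x in [set: 'cV[R]_d] & h in [set h : 'cV[R]_(ncols S) | h != 0]].

Definition TS S x (h : 'cV[R]_(ncols S)) : \bar R :=
  ((dot (gradS S x) h + 2^-1 * dot (hessS S x *m h) h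
    + MS S / 6 * enorm (mat S *m h) ^+ 3)%:E + psi (x + mat S *m h)%R)%E.

(* Minimizers of TS need not be unique (e.g. when MS S = 0); any is allowed. *)
Definition sscn_step S x x' : Prop :=
  exists h : 'cV[R]_(ncols S),
    (forall h' : 'cV[R]_(ncols S), (TS x h <= TS x h')%E) /\
    x' = x + mat S *m h.

Variables (disp : measure_display) (Omega : measurableType disp).
Variables (P : probability Omega R) (D : probability (borelType (sketch R d)) R).
Variables (S : nat -> Omega -> borelType (sketch R d)).
Variables (x : nat -> Omega -> borelType 'cV[R]_d).

(* The sigma-algebra generated by S_0, ..., S_(k-1) and x^0, ..., x^k. *)
Definition past (k : nat) : set (set Omega) :=
  <<s (\bigcup_(i in [set i | (i < k)%N]) g_sigma_algebra_preimage (S i)) `|`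
      (\bigcup_(i in [set i | (i <= k)%N]) g_sigma_algebra_preimage (x i)) >>.

Definition sscn (x0 : 'cV[R]_d) : Prop :=
  [/\ (forall k, measurable_fun setT (S k)) /\
      (forall k, measurable_fun setT (x k)),
      forall w, x 0 w = x0,
      forall k B, measurable B -> P (S k @^-1` B) = D B,
      forall k A B, past k A -> measurable B ->
        P (A `&` S k @^-1` B) = (P A * P (S k @^-1` B))%E
    & forall k, \forall w \ae P, sscn_step (S k w) (x k w) (x k.+1 w)].

End SSCN.

(* Main.v *)
(* Let p = tau / d and let P be the projection of the sketch S.  Comparing the
   minimizer h^k of T_S with the h for which S h = P v, v = a (x* - x^k), bounds
   F(x^{k+1}) by a cubic model in P v, for every step size a in [0, 1].
   Separability makes psi(x + P v) affine in P; writing P v = p v + (P - p) v and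
   using the curvature bound L on the second part only, together with
   |P v|^3 <= |v| <P v, v>, makes the whole bound affine in P, so its mean depends
   on E[P] = p I only.  Since S_k is independent of x^k and x^k stays in the level
   set of x^0, Fubini gives, for the mean gaps D_k = E[F(x^k)] - F*,
     D_{k+1} <= (1 - a p) D_k + a^2 L p (1 - p) R^2 / 2 + a^3 M p R^3 / 3.
   With A_k = 4 / (3 p^3) + 1^2 + ... + k^2 and a = (k + 1)^2 / (p A_{k+1}) <= 1 the
   inequality telescopes for A_k D_k, and A_k >= k^3 / 3 gives the rate. *)

Require Import Defs.
From HB Require Import structures.
From mathcomp Require Import all_boot all_order all_algebra.
From mathcomp Require Import all_classical all_reals all_analysis.
From mathcomp Require Import measurable_realfun ring lra.

Set Implicit Arguments.
Unset Strict Implicit.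
Unset Printing Implicit Defensive.

Import Order.TTheory GRing.Theory Num.Theory.
Import numFieldNormedType.Exports.

Local Open Scope classical_set_scope.
Local Open Scope ring_scope.

(** * Euclidean inner product, norm and operator norm *)

Section EuclideanTheory.
Variables (R : realType).

Lemma dotE n (u v : 'cV[R]_n) : dot u v = \sum_i u i 0 * v i 0.
Proof. by rewrite /dot mxE; apply: eq_bigr => i _; rewrite mxE. Qed.

Lemma dotC n (u v : 'cV[R]_n) : dot u v = dot v u.
Proof. by rewrite !dotE; apply: eq_bigr => i _; rewrite mulrC. Qed.

Lemma dotDl n (u v w : 'cV[R]_n) : dot (u + v) w = dot u w + dot v w.
Proof. by rewrite /dot linearD/= mulmxDl mxE. Qed.

Lemma dotDr n (u v w : 'cV[R]_n) : dot w (u + v) = dot w u + dot w v.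
Proof. by rewrite !(dotC w) dotDl. Qed.

Lemma dotZl n a (u v : 'cV[R]_n) : dot (a *: u) v = a * dot u v.
Proof. by rewrite /dot linearZ/= -scalemxAl mxE. Qed.

Lemma dotZr n a (u v : 'cV[R]_n) : dot u (a *: v) = a * dot u v.
Proof. by rewrite !(dotC u) dotZl. Qed.

Lemma dotNl n (u v : 'cV[R]_n) : dot (- u) v = - dot u v.
Proof. by rewrite -scaleN1r dotZl mulN1r. Qed.

Lemma dotNr n (u v : 'cV[R]_n) : dot u (- v) = - dot u v.
Proof. by rewrite !(dotC u) dotNl. Qed.

Lemma dot0l n (u : 'cV[R]_n) : dot 0 u = 0.
Proof. by rewrite -(scale0r 0) dotZl mul0r. Qed.

Definition dotL := (dotDl, dotDr, dotNl, dotNr, dotZl, dotZr).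

Lemma dot_mulmx m n (A : 'M[R]_(m, n)) u v : dot (A *m u) v = dot u (A^T *m v).
Proof. by rewrite /dot trmx_mul mulmxA. Qed.

Lemma dot_ge0 n (u : 'cV[R]_n) : 0 <= dot u u.
Proof. by rewrite dotE sumr_ge0// => i _; rewrite -expr2 sqr_ge0. Qed.

Lemma dot_eq0 n (u : 'cV[R]_n) : (dot u u == 0) = (u == 0).
Proof.
apply/eqP/eqP => [|->]; last by rewrite dot0l.
rewrite dotE => /psumr_eq0P u0; apply/colP => i; rewrite mxE.
by apply/eqP; rewrite -sqrf_eq0 expr2 u0// => j _; rewrite -expr2 sqr_ge0.
Qed.

Lemma enorm_ge0 n (u : 'cV[R]_n) : 0 <= enorm u.
Proof. exact: sqrtr_ge0. Qed.

Lemma sqr_enorm n (u : 'cV[R]_n) : enorm u ^+ 2 = dot u u.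
Proof. by rewrite sqr_sqrtr ?dot_ge0. Qed.

Lemma enorm_eq0 n (u : 'cV[R]_n) : (enorm u == 0) = (u == 0).
Proof. by rewrite -sqrf_eq0 sqr_enorm dot_eq0. Qed.

Lemma enormZ n a (u : 'cV[R]_n) : enorm (a *: u) = `|a| * enorm u.
Proof.
by rewrite /enorm dotZl dotZr mulrA -expr2 sqrtrM ?sqr_ge0// sqrtr_sqr.
Qed.

Lemma enormN n (u : 'cV[R]_n) : enorm (- u) = enorm u.
Proof. by rewrite -scaleN1r enormZ normrN1 mul1r. Qed.

(** The squared norm of [dot u u *: v - dot u v *: u] is [dot u u] times the Gram determinant of [u]
    and [v], so this determinant is nonnegative. *)
Lemma cauchy_schwarz n (u v : 'cV[R]_n) : `|dot u v| <= enorm u * enorm v.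
Proof.
have [->|u0] := eqVneq u 0; first by rewrite dot0l normr0 mulr_ge0 ?enorm_ge0.
rewrite -(@ler_pXn2r _ 2)// ?nnegrE ?mulr_ge0 ?enorm_ge0//.
rewrite exprMn !sqr_enorm real_normK ?num_real//.
have uu : 0 < dot u u by rewrite lt_def dot_eq0 u0 dot_ge0.
have := dot_ge0 (dot u u *: v - dot u v *: u).
rewrite !dotL (dotC v u) => h.
rewrite -subr_ge0 -(pmulr_rge0 _ uu).
by apply: le_trans h _; rewrite le_eqVlt; apply/orP; left; apply/eqP; ring.
Qed.

Lemma ler_dot n (u v : 'cV[R]_n) : dot u v <= enorm u * enorm v.
Proof. exact: le_trans (ler_norm _) (cauchy_schwarz _ _). Qed.

(** Cauchy-Schwarz on each row bounds the set by the Frobenius norm. Without an upper bound the real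
    supremum in [opnorm] would carry no information. *)
Lemma opnorm_ubound m n (A : 'M[R]_(m, n)) :
  has_ubound [set enorm (A *m h) | h in [set h : 'cV[R]_n | enorm h <= 1]].
Proof.
exists (Num.sqrt (\sum_i dot (row i A)^T (row i A)^T)) => _ [h h1 <-].
rewrite /enorm ler_wsqrtr// dotE ler_sum// => i _; rewrite -expr2.
have -> : (A *m h) i 0 = dot (row i A)^T h.
  by rewrite mxE dotE; apply: eq_bigr => j _; rewrite !mxE.
rewrite -[_ ^+ 2]real_normK ?num_real//.
rewrite -sqr_enorm ler_pXn2r ?nnegrE ?enorm_ge0//.
apply: le_trans (cauchy_schwarz _ _) _.
by rewrite ler_piMr ?enorm_ge0.
Qed.

Lemma opnorm_ge0 m n (A : 'M[R]_(m, n)) : 0 <= opnorm A.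
Proof.
rewrite /opnorm; apply: (ub_le_sup (opnorm_ubound A)).
exists 0; last by rewrite mulmx0 /enorm dot0l sqrtr0.
by rewrite /= /enorm dot0l sqrtr0.
Qed.

Lemma enorm_mulmx_le m n (A : 'M[R]_(m, n)) h :
  enorm (A *m h) <= opnorm A * enorm h.
Proof.
have [->|h0] := eqVneq h 0.
  by rewrite mulmx0 /enorm !dot0l sqrtr0 mulr0.
have h1 : 0 < enorm h by rewrite lt_def enorm_eq0 h0 enorm_ge0.
rewrite -ler_pdivrMr//.
have -> : enorm (A *m h) / enorm h = enorm (A *m ((enorm h)^-1 *: h)).
  by rewrite -scalemxAr enormZ mulrC gtr0_norm ?invr_gt0.
rewrite /opnorm; apply: (ub_le_sup (opnorm_ubound A)); eexists; last by [].
by rewrite /= enormZ gtr0_norm ?invr_gt0// mulVf// gt_eqF.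
Qed.

Lemma dot_opnorm_le n (A : 'M[R]_n) u : `|dot (A *m u) u| <= opnorm A * enorm u ^+ 2.
Proof.
apply: le_trans (cauchy_schwarz _ _) _.
by rewrite expr2 mulrA ler_wpM2r ?enorm_ge0 ?enorm_mulmx_le.
Qed.

End EuclideanTheory.

(** * Derivatives along lines and a one-dimensional Taylor bound *)

Section LineDerivatives.
Variables (R : realType).

Lemma is_derive_dot (V : normedModType R) n (g : V -> 'cV[R]_n) w y v :
  derivable g y v -> is_derive y v (fun z => dot (g z) w) (dot ('D_v g y) w).
Proof.
move=> dg; have -> : (fun z => dot (g z) w) = \sum_i (fun z => g z i 0 * w i 0).
  by apply/funext => z; rewrite dotE fct_sumE.
rewrite dotE; apply: is_derive_sum => i.
have /derivable_mxP/(_ i 0) dgi := dg.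
rewrite (derive_mx dg) mxE.
rewrite mulrC; have /derivableP dgi' := dgi.
have := is_deriveM dgi' (is_derive_cst (w i 0) y v).
by rewrite scaler0 add0r.
Qed.

(** The difference quotient of the restriction to the line is literally the directional one. *)
Lemma is_derive_line (V W : normedModType R) (g : V -> W) x u t :
  derivable g (x + t *: u) u ->
  is_derive t 1 (fun s : R => g (x + s *: u)) ('D_u g (x + t *: u)).
Proof.
have E : (fun h : R => h^-1 *: (((fun s : R => g (x + s *: u)) \o shift t) (h *: 1)
            - g (x + t *: u)))
   = (fun h : R => h^-1 *: ((g \o shift (x + t *: u)) (h *: u) - g (x + t *: u))).
  apply/funext => h /=; congr (_ *: (g _ - _)).
  by rewrite [h *: 1]mulr1 scalerDl addrCA.
by move=> dg; split; rewrite ?/derivable ?/derive E.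
Qed.

Lemma nonneg_primitive (g g' : R -> R) :
  (forall t : R, is_derive t 1 g (g' t)) ->
  (forall t, 0 <= t -> 0 <= g' t) -> 0 <= g 0 -> forall t, 0 <= t -> 0 <= g t.
Proof.
move=> dg g'0 g0 t t0; apply: le_trans g0 _.
have [|c] := @MVT_segment _ g g' 0 t t0 (fun s _ => dg s).
  apply: derivable_within_continuous => s _; exact: ex_derive.
rewrite in_itv/= => /andP[c0 _] e.
by rewrite -subr_ge0 e subr0 mulr_ge0// g'0.
Qed.

(** Monotonicity replaces an integral remainder: at each order, comparison polynomial minus function
    vanishes at 0 and has as derivative the nonnegative difference of the next order. The lower
    bound is the upper bound for the negated functions. *)
Lemma cubic_taylor_le (p0 p1 p2 p3 : R -> R) (K : R) :
  (forall t : R, is_derive t 1 p0 (p1 t)) ->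
  (forall t : R, is_derive t 1 p1 (p2 t)) ->
  (forall t : R, is_derive t 1 p2 (p3 t)) ->
  (forall t, `|p3 t| <= K) ->
  `|p0 1 - p0 0 - p1 0 - p2 0 / 2| <= K / 6.
Proof.
suff H (q0 q1 q2 q3 : R -> R) : (forall t : R, is_derive t 1 q0 (q1 t)) ->
  (forall t : R, is_derive t 1 q1 (q2 t)) ->
  (forall t : R, is_derive t 1 q2 (q3 t)) ->
  (forall t, q3 t <= K) -> q0 1 - q0 0 - q1 0 - q2 0 / 2 <= K / 6.
  move=> d0 d1 d2 h; rewrite ler_norml; apply/andP; split; last first.
    by apply: (H _ _ _ _ d0 d1 d2) => t; apply: le_trans (ler_norm _) (h t).
  have k : - p0 1 - - p0 0 - - p1 0 - - p2 0 / 2 <= K / 6.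
    apply: (H (- p0) (- p1) (- p2) (- p3)) => t; try exact: is_deriveN.
    by apply: le_trans (ler_norm _) _; rewrite normrN.
  lra.
move=> d0 d1 d2 h.
have e2 : forall t, 0 <= t -> 0 <= q2 0 + K * t - q2 t.
  apply: (@nonneg_primitive _ (fun t => K - q3 t)); last by rewrite mulr0 addr0 subrr.
    move=> t; apply: is_derive_eq.
    by rewrite /GRing.scale/=; ring.
  by move=> t _; rewrite subr_ge0.
have e1 : forall t, 0 <= t -> 0 <= q1 0 + q2 0 * t + K / 2 * t ^+ 2 - q1 t.
  apply: (@nonneg_primitive _ (fun t => q2 0 + K * t - q2 t)) => //.
    move=> t; apply: is_derive_eq.
    by rewrite /GRing.scale/=; field.
  by rewrite expr0n !mulr0 !addr0 subrr.
have e0 : forall t, 0 <= t ->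
    0 <= q0 0 + q1 0 * t + q2 0 / 2 * t ^+ 2 + K / 6 * t ^+ 3 - q0 t.
  apply: (@nonneg_primitive _ (fun t => q1 0 + q2 0 * t + K / 2 * t ^+ 2 - q1 t)) => //.
    move=> t; apply: is_derive_eq.
    by rewrite /GRing.scale/=; field.
  by rewrite !expr0n !mulr0 !addr0 subrr.
have := e0 1 ler01; rewrite !expr1n; lra.
Qed.

(** The difference quotients at [t] are bounded by [C], and the bound passes to the limit. *)
Lemma lipschitz_derive_le (g : R -> R) (g' C t : R) : is_derive t 1 g g' ->
  (forall s, `|g s - g t| <= C * `|s - t|) -> `|g'| <= C.
Proof.
move=> [dg <-] lip.
apply: (cvgr_to_le (cvg_norm dg)); near=> h.
have h0 : 0 < `|h| by rewrite normr_gt0; near: h; exact: nbhs_dnbhs_neq.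
rewrite normrZ normfV ler_pdivrMl// mulrC.
by apply: le_trans (lip _) _; rewrite /= addrK [_ *: _]mulr1.
Unshelve. all: end_near.
Qed.

End LineDerivatives.

(** * Gradient, Hessian and third derivative; second-order models of f *)

Section FrechetDerivatives.
Variables (R : realType) (d : nat).
Implicit Types (f : 'cV[R]_d -> R) (x y u v : 'cV[R]_d).

Lemma derive_grad f y u : differentiable f y -> 'D_u f y = dot (grad f y) u.
Proof.
move=> df; rewrite deriveE//.
have {1}-> : u = \sum_i u i 0 *: delta_mx i 0.
  apply/colP => j; rewrite summxE (bigD1 j)//= big1 ?addr0.
    by rewrite !mxE !eqxx mulr1.
  by move=> i ij; rewrite !mxE eq_sym (negbTE ij) mulr0.
rewrite linear_sum dotE; apply: eq_bigr => i _.
by rewrite linearZ/= /grad mxE deriveE// mulrC.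
Qed.

Lemma derive_hess f y u : differentiable (grad f) y ->
  'D_u (grad f) y = hess f y *m u.
Proof.
move=> dg; rewrite derive_mx; last exact: diff_derivable.
apply/colP => i; rewrite !mxE.
have dgi : differentiable (fun z => grad f z i 0) y.
  exact: (differentiable_comp dg (differentiable_coord _ _ _)).
rewrite derive_grad// dotE; apply: eq_bigr => j _.
by rewrite !mxE.
Qed.

Variable f : 'cV[R]_d -> R.
Hypothesis f_diff3 : three_times_differentiable f.

Lemma derive_f u y : 'D_u f y = dot (grad f y) u.
Proof. by have [df _ _] := f_diff3; exact: derive_grad. Qed.

Lemma is_derive_dot_grad u y :
  is_derive y u (fun z => dot (grad f z) u) (dot (hess f y *m u) u).
Proof.
have [_ dg _] := f_diff3.
rewrite -derive_hess//; apply: is_derive_dot; exact: diff_derivable.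
Qed.

Lemma derive2_f u y : 'D_u (fun z => 'D_u f z) y = dot (hess f y *m u) u.
Proof.
rewrite (_ : (fun z => _) = (fun z => dot (grad f z) u)); last first.
  by apply/funext => z; exact: derive_f.
by have ? := is_derive_dot_grad u y; rewrite derive_val.
Qed.

Lemma deriv3E y u : deriv3 f y u = 'D_u (fun z => dot (hess f z *m u) u) y.
Proof. by rewrite /deriv3 (funext (derive2_f u)). Qed.

Lemma derivable_hess_mul u y : derivable (fun z => hess f z *m u) y u.
Proof.
have [_ _ dh] := f_diff3.
apply/derivable_mxP => i k.
rewrite (_ : (fun z => _) = \sum_(j < d) (fun z => u j 0 * hess f z i j)).
  apply: derivable_sum => j.
  have : derivable (hess f) y u by exact: diff_derivable.
  move=> /derivable_mxP/(_ i j) h.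
  have := derivableM (derivable_cst (u j 0) y u) h; exact.
apply/funext => z; rewrite fct_sumE mxE (ord1 k).
by apply: eq_bigr => j _; rewrite mulrC.
Qed.

(** These are the three successive derivatives to which [cubic_taylor_le] is applied. *)
Lemma line_derivatives x u (t : R) :
  [/\ is_derive t 1 (fun s : R => f (x + s *: u)) (dot (grad f (x + t *: u)) u),
      is_derive t 1 (fun s : R => dot (grad f (x + s *: u)) u)
        (dot (hess f (x + t *: u) *m u) u)
    & is_derive t 1 (fun s : R => dot (hess f (x + s *: u) *m u) u)
        (deriv3 f (x + t *: u) u)].
Proof.
have [df dg _] := f_diff3; split.
- rewrite -derive_f; apply: is_derive_line; exact: diff_derivable.
- have h := is_derive_dot_grad u (x + t *: u).
  by have := is_derive_line (@ex_derive _ _ _ _ _ _ _ h); rewrite derive_val.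
- have h := is_derive_dot u (@derivable_hess_mul u (x + t *: u)).
  have := is_derive_line (@ex_derive _ _ _ _ _ _ _ h).
  by rewrite deriv3E.
Qed.

Lemma second_order_model_le x u (K : R) : (forall y, `|deriv3 f y u| <= K) ->
  `|f (x + u) - f x - dot (grad f x) u - dot (hess f x *m u) u / 2| <= K / 6.
Proof.
move=> hK.
have := @cubic_taylor_le _ _ _ _ _ K (fun t => let: And3 p _ _ := line_derivatives x u t in p)
  (fun t => let: And3 _ p _ := line_derivatives x u t in p)
  (fun t => let: And3 _ _ p := line_derivatives x u t in p) (fun t => hK _).
by rewrite scale1r scale0r addr0.
Qed.

(** The third derivative is the slope at 0 of the curvature [dot (hess f (y + s *: u) *m u) u], and
    the Lipschitz Hessian bounds the increments of this curvature from 0 by [M * enorm u ^+ 3] times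
    [|s|]. *)
Lemma deriv3_le (M : R) y u : lipschitz_hessian f M ->
  `|deriv3 f y u| <= M * enorm u ^+ 3.
Proof.
move=> lip; have [_ _] := line_derivatives y u 0; rewrite scale0r addr0.
move=> /lipschitz_derive_le; apply => s.
rewrite scale0r addr0 subr0 -dotNl -dotDl -mulNmx -mulmxDl.
apply: le_trans (dot_opnorm_le _ _) _.
rewrite (exprS _ 2) mulrA [leRHS]mulrAC ler_wpM2r ?sqr_ge0//.
apply: le_trans (lip _ _) _.
by rewrite [y + _]addrC addrK enormZ mulrAC mulrA.
Qed.

Lemma deriv3_MS (M : R) (S : sketch R d) h y : lipschitz_hessian f M ->
  `|deriv3 f y (mat S *m h)| <= MS f S * enorm (mat S *m h) ^+ 3.
Proof.
move=> lip; have [Sh0|Sh0] := eqVneq (mat S *m h) 0.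
  rewrite Sh0 /deriv3 derive0 normr0.
  by rewrite /enorm dot0l sqrtr0 expr0n mulr0.
have Sh1 : 0 < enorm (mat S *m h) ^+ 3.
  by rewrite exprn_gt0// lt_def enorm_ge0 enorm_eq0 Sh0.
rewrite -ler_pdivrMr// /MS; apply: ub_le_sup; last first.
  exists y => //; exists h => //.
  by apply: contraNN Sh0 => /eqP ->; rewrite mulmx0.
(* The absolute value covers directions with [mat S *m k = 0], where the quotient is 0 by the
   convention for division by 0. *)
exists `|M| => _ [z _ [k _ <-]].
have [Sk0|Sk0] := eqVneq (mat S *m k) 0.
  by rewrite Sk0 /deriv3 derive0 normr0 mul0r.
rewrite ler_pdivrMr; last by rewrite exprn_gt0// lt_def enorm_ge0 enorm_eq0 Sk0.
apply: le_trans (deriv3_le _ _ lip) _.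
by rewrite ler_wpM2r ?exprn_ge0 ?enorm_ge0 ?ler_norm.
Qed.

Lemma convex_segment_le x y (a : R) : convex_function (E := 'cV[R]_d) setT f ->
  0 <= a <= 1 -> f (a *: x + (1 - a) *: y) <= a * f x + (1 - a) * f y.
Proof.
move=> cf /andP[a0 a1].
by have := cf (Itv01 a0 a1) x y (in_setT _) (in_setT _); rewrite convRE.
Qed.

(** Convexity at the midpoint of [x + t *: u] and [x - t *: u], combined with the cubic upper bound
    at both ends, gives [0 <= q + t * c / 3] for every [t > 0]. A negative [q] is refuted by a small
    [t]. *)
Lemma hess_psd (M : R) x u : lipschitz_hessian f M ->
  convex_function (E := 'cV[R]_d) setT f -> 0 <= dot (hess f x *m u) u.
Proof.
move=> lip cf; rewrite leNgt; apply/negP => neg.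
set q := dot _ _ in neg.
pose c := M * enorm u ^+ 3.
have up s : f (x + s *: u) <=
    f x + s * dot (grad f x) u + s ^+ 2 * q / 2 + `|s| ^+ 3 * c / 6.
  have h y : `|deriv3 f y (s *: u)| <= `|s| ^+ 3 * c.
    apply: le_trans (deriv3_le _ _ lip) _.
    by rewrite enormZ exprMn /c mulrCA.
  have := second_order_model_le x h.
  rewrite -scalemxAr !dotL -/q ler_norml => /andP[_]; lra.
have key (t : R) : 0 < t -> 0 <= q + t * c / 3.
  move=> t0.
  have hh : 0 <= (2^-1 : R) <= 1 by apply/andP; split; lra.
  have := convex_segment_le (x + t *: u) (x + (- t) *: u) cf hh.
  have -> : 2^-1 *: (x + t *: u) + (1 - 2^-1) *: (x + - t *: u) = x.
    by apply/colP => i; rewrite !mxE; field.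
  have := up t; have := up (- t); rewrite normrN (gtr0_norm t0) sqrrN => h1 h2 h3.
  have h4 : 0 <= t ^+ 2 * (q + t * c / 3) by lra.
  by rewrite pmulr_rge0 ?exprn_gt0// in h4.
have c1 : 0 < `|c| + 1 by rewrite ltr_wpDl.
(* At this [t] the right side of [key] is [q] times a positive number; the summand 1 keeps the
   denominator positive when [c = 0]. *)
have /key : 0 < - q / (`|c| + 1) by rewrite divr_gt0 ?oppr_gt0.
rewrite -(pmulr_rge0 _ c1) leNgt => /negP; apply.
have -> : (`|c| + 1) * (q + - q / (`|c| + 1) * c / 3) = q * (`|c| + 1 - c / 3).
  by field; rewrite gt_eqF.
rewrite nmulr_rlt0//; have := ler_norm c; have := normr_ge0 c; lra.
Qed.

End FrechetDerivatives.

(** * The orthogonal projection onto the range of a sketch *)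

Section Projection.
Variables (R : realType) (d : nat) (S : sketch R d).
Implicit Types u v : 'cV[R]_d.

(** A kernel vector of the Gram matrix has an image under [mat S] of squared norm 0, and full column
    rank makes [mat S] injective. *)
Lemma gram_unit : full_column_rank S -> (mat S)^T *m mat S \in unitmx.
Proof.
rewrite /full_column_rank /= => rS.
rewrite -row_free_unit -kermx_eq0; apply/rowV0P => u /sub_kermxP uG.
have /eqP : dot (mat S *m u^T) (mat S *m u^T) = 0.
  by rewrite /dot trmx_mul trmxK mulmxA -(mulmxA u) uG mul0mx mxE.
rewrite dot_eq0 => /eqP/(congr1 trmx); rewrite trmx_mul trmxK trmx0.
have fr : row_free (mat S)^T by rewrite -row_leq_rank mxrank_tr rS.
by move=> h; apply: (row_free_inj fr); rewrite h mul0mx.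
Qed.

Lemma projS_tr : (projS S)^T = projS S.
Proof. by rewrite /projS !trmx_mul trmxK trmx_inv trmx_mul trmxK mulmxA. Qed.

Hypothesis fcr : full_column_rank S.

Lemma projS_idem : projS S *m projS S = projS S.
Proof.
rewrite {1}/projS -mulmxA; congr (_ *m _).
by rewrite /projS !mulmxA mulmxV ?gram_unit// mul1mx.
Qed.

Lemma dot_projS u v : dot (projS S *m u) (projS S *m v) = dot (projS S *m u) v.
Proof. by rewrite [LHS]dot_mulmx projS_tr mulmxA projS_idem [RHS]dot_mulmx projS_tr. Qed.

(** |Pv|^2 = <Pv, v> <= |Pv| |v|, after which one factor |Pv| cancels. *)
Lemma enorm_projS_le v : enorm (projS S *m v) <= enorm v.
Proof.
have [h|h] := eqVneq (enorm (projS S *m v)) 0; first by rewrite h enorm_ge0.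
have h0 : 0 < enorm (projS S *m v) by rewrite lt_def h enorm_ge0.
rewrite -(ler_pM2l h0) -[leLHS]expr2 sqr_enorm dot_projS; exact: ler_dot.
Qed.

Lemma projS_entryE i j : projS S i j = dot (projS S *m delta_mx j 0) (delta_mx i 0).
Proof.
rewrite dotE (bigD1 i)//= big1 ?addr0; last first.
  by move=> k ki; rewrite [delta_mx i 0 k 0]mxE (negbTE ki) mulr0.
by rewrite -colE !mxE !eqxx mulr1.
Qed.

Lemma enorm_delta (n : nat) (i : 'I_n) : enorm (delta_mx i 0 : 'cV[R]_n) = 1.
Proof.
rewrite /enorm dotE (bigD1 i)//= big1 ?addr0; last first.
  by move=> k ki; rewrite !mxE (negbTE ki) mulr0.
by rewrite !mxE !eqxx mulr1 sqrtr1.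
Qed.

Lemma projS_entry_le i j : `|projS S i j| <= 1.
Proof.
rewrite projS_entryE; apply: le_trans (cauchy_schwarz _ _) _.
rewrite enorm_delta mulr1; apply: le_trans (enorm_projS_le _) _.
by rewrite enorm_delta.
Qed.

End Projection.

(** * Continuity of matrix operations, entry by entry *)

Section EntrywiseContinuity.
Variables (R : realType) (T : topologicalType).

Lemma continuous_sumr (I : Type) (r : seq I) (P : pred I) (F : I -> T -> R) :
  (forall i, continuous (F i)) -> continuous (fun t => \sum_(i <- r | P i) F i t).
Proof.
by move=> cF; apply: continuous_big => //; exact: add_continuous.
Qed.

Lemma continuous_prodr (I : Type) (r : seq I) (P : pred I) (F : I -> T -> R) :
  (forall i, continuous (F i)) -> continuous (fun t => \prod_(i <- r | P i) F i t).
Proof.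
by move=> cF; apply: continuous_big => //; exact: mul_continuous.
Qed.

Lemma continuous_mulmx m n p (A : T -> 'M[R]_(m, n)) (B : T -> 'M[R]_(n, p)) :
  (forall i j, continuous (fun t => A t i j)) ->
  (forall i j, continuous (fun t => B t i j)) ->
  forall i j, continuous (fun t => (A t *m B t) i j).
Proof.
move=> cA cB i j.
rewrite (_ : (fun t => _) = fun t => \sum_k A t i k * B t k j); last first.
  by apply/funext => t; rewrite mxE.
apply: continuous_sumr => k t; apply: cvgM; [exact: cA|exact: cB].
Qed.

Lemma continuous_det n (A : T -> 'M[R]_n) :
  (forall i j, continuous (fun t => A t i j)) -> continuous (fun t => \det (A t)).
Proof.
move=> cA; apply: continuous_sumr => s t.
apply: cvgM; first exact: cvg_cst.
by apply: continuous_prodr => i; exact: cA.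
Qed.

Lemma continuous_adjugate n (A : T -> 'M[R]_n) :
  (forall i j, continuous (fun t => A t i j)) ->
  forall i j, continuous (fun t => (\adj (A t)) i j).
Proof.
move=> cA i j.
rewrite (_ : (fun t => _) = fun t => (-1) ^+ (j + i) * \det (row' j (col' i (A t)))); last first.
  by apply/funext => t; rewrite mxE.
move=> t; apply: cvgM; first exact: cvg_cst.
apply: continuous_det => k l.
rewrite (_ : (fun t => _) = fun t => A t (lift j k) (lift i l)); first exact: cA.
by apply/funext => z; rewrite !mxE.
Qed.

End EntrywiseContinuity.

(** * Borel measurability of the projection and of closed functions *)

Section BorelMeasurability.
Variables (R : realType).

Lemma continuous_borel_measurable (T : ptopologicalType) (g : T -> R) :
  continuous g -> measurable_fun setT (g : borelType T -> R).
Proof.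
move=> /continuousP cg; apply: (measurability _ (RGenOpens.measurableE R)).
move=> _ [_ [a [b ->] <-]]; rewrite setTI; apply: sub_sigma_algebra.
by apply: cg; exact: interval_open.
Qed.

Lemma inv_measurable : measurable_fun setT (@GRing.inv R).
Proof.
(* Squaring reduces inversion to a real power on nonnegative numbers; at 0 both sides are 0. *)
rewrite (_ : @GRing.inv R = fun x => x * ((x ^+ 2) `^ (-1))); last first.
  apply/funext => x; rewrite powR_inv1 ?sqr_ge0//.
  have [->|x0] := eqVneq x 0; first by rewrite invr0 mul0r.
  by rewrite expr2 invfM mulrA divff// mul1r.
apply: measurable_funM => //.
exact: (measurableT_comp (@measurable_powR R (-1)) (@exprn_measurable R setT 2)).
Qed.

(** Each sublevel set is a slice of the closed epigraph, hence closed. *)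
Lemma closed_fun_measurable d (psi : 'cV[R]_d -> \bar R) :
  closed_fun psi -> measurable_fun setT (psi : borelType 'cV[R]_d -> \bar R).
Proof.
move=> cpsi; apply: (measurability _ (ErealGenOInfty.measurableE R)).
move=> /= _ [_ [a ->]] <-; rewrite setTI.
have -> : psi @^-1` `]a%:E, +oo[ = ~` [set x | psi x <= a%:E]%E.
  by apply/seteqP; split => x /=; rewrite in_itv/= andbT ltNge => /negP.
apply: measurableC; rewrite -[X in measurable X]setCK.
apply: measurableC; apply: sub_sigma_algebra; apply: closed_openC.
have := @preimage_closed _ _ (fun x : 'cV[R]_d => (x, a)) _ _ cpsi.
apply => x _.
exact: (@cvg_pair _ _ _ (nbhs x) (nbhs x) (nbhs a) _ _ _ id (cst a) cvg_id (cvg_cst _)).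
Qed.

(** Every open set is the countable union of the boxes with rational centre and radius [1 / (n + 1)]
    that it contains, and the preimage of a box is a finite intersection of conditions on
    coordinates. *)
Lemma measurable_fun_cV (d0 : measure_display) (T : measurableType d0) d
    (g : T -> 'cV[R]_d) :
  (forall i, measurable_fun setT (fun t => g t i 0)) ->
  measurable_fun setT (g : T -> borelType 'cV[R]_d).
Proof.
move=> mg; have E : @measurable _ (borelType 'cV[R]_d) = <<s (@open 'cV[R]_d) >> by [].
apply: (measurability _ E).
move=> _ [U oU <-]; rewrite setTI.
pose rr (q : rat) : R := ratr q; pose dl (n : nat) : R := n.+1%:R^-1.
pose box (q : 'cV[rat]_d) (n : nat) :=
  [set z : 'cV[R]_d | forall i, `|z i 0 - rr (q i 0)| < dl n].
have -> : g @^-1` U = \bigcup_(qn in [set qn : 'cV[rat]_d * nat | box qn.1 qn.2 `<=` U])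
   g @^-1` (box qn.1 qn.2).
  apply/seteqP; split => [t Ut|t [[q n] /= qnU] qnt]; last exact: qnU.
  have /nbhs_ballP[e /= e0 eU] : nbhs (g t) U by exact: open_nbhs_nbhs.
  have [n _ /(_ n (leqnn n)) ne] := near_infty_natSinv_lt (PosNum (divr_gt0 e0 (ltr0Sn R 1))).
  have {}ne : dl n < e / 2 by [].
  have n0 : 0 < dl n by rewrite invr_gt0 ltr0n.
  have /choice[r rP] i : exists q, g t i 0 < rr q < g t i 0 + dl n.
    have /rat_in_itvoo[q] : g t i 0 < g t i 0 + dl n by rewrite ltrDl.
    by rewrite in_itv/= => qP; exists q.
  exists (\col_i r i, n) => /=; last first.
    move=> i; rewrite mxE; have /andP[h1 h2] := rP i.
    by rewrite ltr_norml; apply/andP; split; lra.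
  (* Both [w] and [g t] lie within [dl n] of the rational centre in each coordinate, and
     [dl n < e / 2]. *)
  move=> w wb; apply: eU; split => // i j; rewrite (ord1 j) /ball/=.
  have /andP[h1 h2] := rP i; have := wb i.
  rewrite mxE !ltr_norml => /andP[h3 h4].
  by apply/andP; split; lra.
rewrite bigcup_mkcond; apply: countable_bigcupT_measurable => // -[q n].
case: ifPn => // _.
rewrite (_ : _ @^-1` _ = \bigcap_(i in [set: 'I_d]) [set t | `|g t i 0 - rr (q i 0)| < dl n]).
  apply: fin_bigcap_measurable => // i _.
  rewrite -[X in measurable X]setTI.
  rewrite (_ : [set t | _] = (fun t => `|g t i 0 - rr (q i 0)| < dl n) @^-1` [set true]) //.
  apply: measurable_fun_ltr => //.
  by apply: measurableT_comp => //; apply: measurable_funB.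
by apply/seteqP; split => [t h i _|t h i]; apply: h.
Qed.
(** Where the Gram determinant is nonzero the inverse is the adjugate over the determinant.
    Continuity of the pieces is checked separately for each number of columns, the topology being a
    disjoint union. *)
Lemma measurable_projS d i j :
  measurable_fun setT (fun S : borelType (sketch R d) => projS S i j).
Proof.
pose G n (A : 'M[R]_(d, n)) := A^T *m A.
pose f n (A : 'M[R]_(d, n)) := (A *m \adj (G n A) *m A^T) i j.
(* The value for a singular Gram matrix, on which [invmx] returns its argument. *)
pose f0 n (A : 'M[R]_(d, n)) := (A *m G n A *m A^T) i j.
pose g n (A : 'M[R]_(d, n)) := \det (G n A).
pose F (S : sketch R d) := f _ (mat S).
pose F0 (S : sketch R d) := f0 _ (mat S).
pose D (S : sketch R d) := g _ (mat S).
have cT n k l : continuous (fun A : 'M[R]_(d, n) => A^T k l).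
  rewrite (_ : (fun A : 'M[R]_(d, n) => _) = (fun A => A l k)); first exact: coord_continuous.
  by apply/funext => A; rewrite mxE.
have cI n k l : continuous (fun A : 'M[R]_(d, n) => A k l) by exact: coord_continuous.
have cG n k l : continuous (fun A : 'M[R]_(d, n) => G n A k l).
  by apply: continuous_mulmx; [exact: cT|exact: cI].
have mF : measurable_fun setT (F : borelType (sketch R d) -> R).
  apply: continuous_borel_measurable; apply: (@sigT_continuous _ _ _ f) => n.
  apply: continuous_mulmx; last exact: cT.
  by apply: continuous_mulmx; [exact: cI|exact/continuous_adjugate/cG].
have mF0 : measurable_fun setT (F0 : borelType (sketch R d) -> R).
  apply: continuous_borel_measurable; apply: (@sigT_continuous _ _ _ f0) => n.
  apply: continuous_mulmx; last exact: cT.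
  by apply: continuous_mulmx; [exact: cI|exact: cG].
have mD : measurable_fun setT (D : borelType (sketch R d) -> R).
  apply: continuous_borel_measurable; apply: (@sigT_continuous _ _ _ g) => n.
  exact/continuous_det/cG.
rewrite (_ : (fun S => _) = fun S => if D S == 0 then F0 S else (D S)^-1 * F S); last first.
  apply/funext => -[n A]; rewrite /projS /invmx unitmxE unitfE /D /F /F0 /f /f0 /g /=.
  rewrite -/(G n A); case: eqP => // _.
  by rewrite -scalemxAr -scalemxAl mxE.
apply: measurable_fun_ifT => //; first exact: measurable_fun_eqr.
apply: measurable_funM => //.
exact: (measurableT_comp inv_measurable).
Qed.

End BorelMeasurability.

(** * Deterministic bounds for one step of the method *)

Section OneStep.
Variables (R : realType) (d : nat) (f : 'cV[R]_d -> R) (psi : 'cV[R]_d -> \bar R).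
Variable M : R.
Hypotheses (f_diff3 : three_times_differentiable f) (f_lip : lipschitz_hessian f M).
Implicit Types (x u v : 'cV[R]_d) (S : sketch R d).

Lemma lipschitz_ge0 : (0 < d)%N -> 0 <= M.
Proof.
move=> hd; have := le_trans (opnorm_ge0 _) (f_lip (delta_mx (Ordinal hd) 0) 0).
by rewrite subr0 enorm_delta mulr1.
Qed.

Definition quad x u : R := f x + dot (grad f x) u + dot (hess f x *m u) u / 2.

Lemma f_le_quad x u : f (x + u) <= quad x u + M / 6 * enorm u ^+ 3.
Proof.
have := second_order_model_le f_diff3 x (fun y => deriv3_le f_diff3 y u f_lip).
by rewrite /quad ler_norml => /andP[_]; lra.
Qed.

Lemma quad_le_f x u : quad x u <= f (x + u) + M / 6 * enorm u ^+ 3.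
Proof.
have := second_order_model_le f_diff3 x (fun y => deriv3_le f_diff3 y u f_lip).
by rewrite /quad ler_norml => /andP[+ _]; lra.
Qed.

Lemma f_le_quad_MS S x (h : 'cV[R]_(ncols S)) :
  f (x + mat S *m h) <= quad x (mat S *m h) + MS f S / 6 * enorm (mat S *m h) ^+ 3.
Proof.
have := second_order_model_le f_diff3 x (fun y => deriv3_MS f_diff3 h y f_lip).
by rewrite /quad ler_norml => /andP[_]; lra.
Qed.

Lemma MS_enorm_le S (h : 'cV[R]_(ncols S)) :
  MS f S * enorm (mat S *m h) ^+ 3 <= M * enorm (mat S *m h) ^+ 3.
Proof.
have [->|Sh0] := eqVneq (mat S *m h) 0.
  by rewrite /enorm dot0l sqrtr0 expr0n !mulr0.
(* A nonzero [mat S *m h] forces [d] to be positive, so there is a unit vector to test the Lipschitz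
   condition on. *)
have M0 : 0 <= M.
  apply: lipschitz_ge0; rewrite lt0n; apply: contraNneq Sh0 => d0.
  by apply/eqP/colP => -[i id]; exfalso; move: id; rewrite d0.
rewrite ler_wpM2r ?exprn_ge0 ?enorm_ge0// /MS; apply: ge_sup.
  (* The supremum is bounded by [M] only over a nonempty set; [h] itself is a witness. *)
  eexists; exists 0 => //; exists h => //.
  by apply: contraNN Sh0 => /eqP ->; rewrite mulmx0.
move=> _ [z _ [k _ <-]].
have [Sk0|Sk0] := eqVneq (mat S *m k) 0.
  by rewrite Sk0 /deriv3 derive0 normr0 mul0r.
rewrite ler_pdivrMr ?deriv3_le//.
by rewrite exprn_gt0// lt_def enorm_ge0 enorm_eq0 Sk0.
Qed.

(** Adding the constant f(x) turns the subproblem into a cubic model in the displacement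
    [mat S *m h]. *)
Lemma TS_quad S x (h : 'cV[R]_(ncols S)) :
  ((f x)%:E + TS f psi x h = (quad x (mat S *m h)
     + MS f S / 6 * enorm (mat S *m h) ^+ 3)%:E + psi (x + mat S *m h)%R)%E.
Proof.
rewrite /TS addeA -EFinD /quad; congr (_%:E + _)%E.
have -> : dot (gradS f S x) h = dot (grad f x) (mat S *m h).
  by rewrite /gradS dot_mulmx trmxK.
have -> : dot (hessS f S x *m h) h = dot (hess f x *m (mat S *m h)) (mat S *m h).
  by rewrite /hessS -!mulmxA dot_mulmx trmxK.
by rewrite !addrA (mulrC 2^-1).
Qed.

(** The model with [MS f S] majorizes the objective at the new point, and the chosen [h] does at
    least as well in the model as any [h']. *)
Lemma sscn_step_le S x x' (h' : 'cV[R]_(ncols S)) : sscn_step f psi S x x' ->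
  (objective f psi x' <= (quad x (mat S *m h')
     + MS f S / 6 * enorm (mat S *m h') ^+ 3)%:E + psi (x + mat S *m h')%R)%E.
Proof.
move=> [h [hmin ->]].
apply: (@le_trans _ _ ((f x)%:E + TS f psi x h)%E); last first.
  by rewrite -TS_quad leeD2l.
by rewrite TS_quad /objective leeD2r// lee_fin f_le_quad_MS.
Qed.

(** The competitor [h' = 0] gives monotonicity, which keeps the iterates in the initial level
    set. *)
Lemma sscn_step_decr S x x' : sscn_step f psi S x x' ->
  (objective f psi x' <= objective f psi x)%E.
Proof.
move=> /(sscn_step_le 0); rewrite mulmx0 addr0 /quad mulmx0 dotC dot0l dot0l.
by rewrite /enorm dot0l sqrtr0 expr0n mul0r mulr0 !addr0.
Qed.

(* An upper bound on f(x) + T_S(x, h) at the h with S h = P^S v: the constant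
   M_S is replaced by M. *)
Definition proj_model S x v : \bar R :=
  ((quad x (projS S *m v) + M / 6 * enorm (projS S *m v) ^+ 3)%:E
   + psi (x + projS S *m v)%R)%E.

Lemma projSE S v : projS S *m v =
  mat S *m (invmx ((mat S)^T *m mat S) *m (mat S)^T *m v).
Proof. by rewrite /projS !mulmxA. Qed.

Lemma sscn_step_le_proj_model S x x' v : sscn_step f psi S x x' ->
  (objective f psi x' <= proj_model S x v)%E.
Proof.
move=> st; rewrite /proj_model projSE; set h := invmx _ *m _ *m v.
apply: le_trans (sscn_step_le h st) _.
rewrite leeD2r// lee_fin lerD2l mulrAC [leRHS]mulrAC ler_wpM2r//.
exact: MS_enorm_le.
Qed.

(** This keeps the model above the minimum, so that model minus minimum is a nonnegative
    integrand. *)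
Lemma objective_le_proj_model S x v :
  (objective f psi (x + projS S *m v)%R <= proj_model S x v)%E.
Proof. by rewrite /objective leeD2r// lee_fin f_le_quad. Qed.

End OneStep.

(** * Bounds that are affine in the projection *)

Section ProjModelBound.
Variables (R : realType) (d : nat) (f : 'cV[R]_d -> R) (psi : 'cV[R]_d -> \bar R).
Variables (M L : R).
Implicit Types (x u v w : 'cV[R]_d) (S : sketch R d).

Lemma loewner_le_scalar (H : 'M[R]_d) u :
  loewner_le H L%:M -> dot (H *m u) u <= L * dot u u.
Proof. by move=> /(_ u); rewrite mulmxBl mul_scalar_mx !dotL subr_ge0. Qed.

(* Expanding [P v = p v + (P - p) v] and using [H <= L] on [(P - p) v] alone
   makes the bound affine in [P]. *)
Lemma dot_hess_projS_le S (H : 'M[R]_d) v (p : R) : full_column_rank S ->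
  loewner_le H L%:M ->
  dot (H *m (projS S *m v)) (projS S *m v) <=
    dot (projS S *m v) (p *: (H *m v + H^T *m v) + (L * (1 - 2 * p)) *: v)
    - p ^+ 2 * dot (H *m v) v + L * p ^+ 2 * dot v v.
Proof.
move=> fcr /(loewner_le_scalar (projS S *m v - p *: v)).
have e : dot (H *m (projS S *m v)) v = dot (projS S *m v) (H^T *m v) by rewrite dot_mulmx.
have e1 : dot (H *m v) (projS S *m v) = dot (projS S *m v) (H *m v) by rewrite dotC.
have e2 : dot v (projS S *m v) = dot (projS S *m v) v by rewrite dotC.
rewrite mulmxBr -scalemxAr !dotL (dot_projS fcr) e e1 e2; lra.
Qed.

(** x + Pv = P(x + v) + (I - P)x, so separability applies to the points x + v and x, with [w] the
    difference of the values of the separating map. The same [w] serves for all sketches, which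
    makes psi affine in P. *)
Lemma separable_projS (Dm : set (sketch R d)) x v : separable_fun Dm psi ->
  edom psi x -> edom psi (x + v) ->
  exists2 w, psi (x + v)%R = (psi x + (dot w (const_mx 1))%:E)%E &
    forall S, Dm S ->
      psi (x + projS S *m v)%R = (psi x + (dot (projS S *m w) (const_mx 1))%:E)%E.
Proof.
move=> [sepd [phi [phi1 phi2]]] px py; exists (phi (x + v) - phi x) => [|S DS].
  by rewrite !phi1// -EFinD -dotDl addrCA subrr addr0.
have E : x + projS S *m v = projS S *m (x + v) + (1%:M - projS S) *m x.
  by rewrite mulmxBl mulmxDr mul1mx (addrC (projS S *m x)) addrACA subrr addr0 addrC.
rewrite E phi1; last exact: sepd.
rewrite phi2// phi1// -EFinD -dotDl; congr (dot _ _)%:E.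
by rewrite mulmxBl mulmxBr mul1mx addrCA.
Qed.

End ProjModelBound.

(** * Real random variables with a finite mean *)

Section Means.
Context (disp : measure_display) (T : measurableType disp) (R : realType).
Variable mu : probability T R.

Lemma ae_imply (P Q : T -> Prop) : (forall t, P t -> Q t) ->
  (\forall t \ae mu, P t) -> \forall t \ae mu, Q t.
Proof. by move=> PQ; apply: filterS. Qed.

Lemma ae_imply2 (P1 P2 Q : T -> Prop) : (forall t, P1 t -> P2 t -> Q t) ->
  (\forall t \ae mu, P1 t) -> (\forall t \ae mu, P2 t) -> \forall t \ae mu, Q t.
Proof. by move=> PQ; apply: filterS2. Qed.

Definition has_mean (F : T -> R) (c : R) : Prop :=
  mu.-integrable setT (EFin \o F) /\ (\int[mu]_t (F t)%:E = c%:E)%E.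

Lemma has_meanD F G a b :
  has_mean F a -> has_mean G b -> has_mean (fun t => F t + G t) (a + b).
Proof.
move=> [iF eF] [iG eG]; split.
  by rewrite (_ : _ \o _ = (EFin \o F) \+ (EFin \o G))//; exact: integrableD.
by under eq_integral do rewrite EFinD; rewrite integralD// eF eG.
Qed.

Lemma has_meanZ F a k : has_mean F a -> has_mean (fun t => k * F t) (k * a).
Proof.
move=> [iF eF]; split.
  by rewrite (_ : _ \o _ = (fun t => k%:E * (EFin \o F) t)%E)//; exact: integrableZl.
by under eq_integral do rewrite EFinM; rewrite integralZl// eF.
Qed.

Lemma has_mean_cst k : has_mean (fun=> k) k.
Proof.
split; last by rewrite integral_cst//= probability_setT mule1.
exact: finite_measure_integrable_cst.
Qed.

Lemma has_mean_sum (I : Type) (r : seq I) (F : I -> T -> R) c :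
  (forall i, has_mean (F i) (c i)) ->
  has_mean (fun t => \sum_(i <- r) F i t) (\sum_(i <- r) c i).
Proof.
move=> h; elim: r => [|i r IH].
  under eq_fun do rewrite big_nil.
  rewrite big_nil; exact: has_mean_cst.
under eq_fun do rewrite big_cons.
by rewrite big_cons; exact: has_meanD.
Qed.

(* [r] is not assumed nonnegative everywhere, so the comparison goes
   through [`|r|]. *)
Lemma ae_le_has_mean (g : T -> \bar R) (r : T -> R) c :
  measurable_fun setT g -> (forall t, 0 <= g t)%E -> has_mean r c ->
  (\forall t \ae mu, (g t <= (r t)%:E)%E) -> (\int[mu]_t g t <= c%:E)%E.
Proof.
move=> mg g0 [/integrableP[mr _] <-] gr.
have -> : (\int[mu]_t (r t)%:E = \int[mu]_t (`|r t|)%:E)%E.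
  apply: ae_eq_integral => //.
  + by apply/measurable_EFinP; apply: measurableT_comp => //; apply/measurable_EFinP.
  + move: gr; apply: filterS => t grt _; rewrite ger0_norm//.
    by rewrite -lee_fin; exact: le_trans grt.
apply: ae_ge0_le_integral => //.
- by apply/measurable_EFinP; apply: measurableT_comp => //; apply/measurable_EFinP.
- by move: gr; apply: filterS => t grt _; apply: le_trans grt _; rewrite lee_fin ler_norm.
Qed.

End Means.

(** * Means of linear functions of the random projection *)

Section MeanProjection.
Variables (R : realType) (d : nat) (D : probability (borelType (sketch R d)) R) (p : R).
Hypothesis D_fcr : \forall S \ae D, full_column_rank S.
Hypothesis D_mean : forall i j : 'I_d,
  ('E_D[fun S : borelType (sketch R d) => projS S i j] = ((p%:M : 'M[R]_d) i j)%:E)%E.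

(** The hypothesis on expectations gives the value only; integrability comes from the almost sure
    bound 1 on the entries. *)
Lemma has_mean_projS_entry i j :
  has_mean D (fun S : borelType (sketch R d) => projS S i j) ((p%:M : 'M[R]_d) i j).
Proof.
split; last by rewrite -D_mean unlock.
apply/integrableP; split; first by apply/measurable_EFinP; exact: measurable_projS.
apply: (@le_lt_trans _ _ (\int[D]_S (cst 1 S))%E); last first.
  by rewrite integral_cst//= probability_setT mule1 ltry.
apply: ae_ge0_le_integral => //.
- apply/measurable_EFinP; apply: measurableT_comp => //; exact: measurable_projS.
- by apply: ae_imply D_fcr => S fS _; rewrite /= lee_fin projS_entry_le.
Qed.

Lemma has_mean_dot_projS (a b : 'cV[R]_d) :
  has_mean D (fun S : borelType (sketch R d) => dot (projS S *m a) b) (p * dot a b).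
Proof.
have -> : (fun S : borelType (sketch R d) => dot (projS S *m a) b) =
    (fun S : borelType (sketch R d) => \sum_i \sum_j (a j 0 * b i 0) * projS S i j).
  apply/funext => S; rewrite dotE; apply: eq_bigr => i _.
  by rewrite mxE mulr_suml; apply: eq_bigr => j _; ring.
have -> : p * dot a b = \sum_i \sum_j (a j 0 * b i 0) * (p%:M : 'M[R]_d) i j.
  rewrite -dotZl -mul_scalar_mx dotE; apply: eq_bigr => i _.
  by rewrite mxE mulr_suml; apply: eq_bigr => j _; ring.
apply: has_mean_sum => i; apply: has_mean_sum => j.
exact/has_meanZ/has_mean_projS_entry.
Qed.

(** A diagonal entry of the projection is almost surely at most 1, and its mean is [p]. *)
Lemma mean_le1 : (0 < d)%N -> p <= 1.
Proof.
move=> hd; pose i := Ordinal hd.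
have m := has_meanD (has_mean_cst D 1) (has_meanZ (-1) (has_mean_projS_entry i i)).
rewrite -subr_ge0 -lee_fin.
have -> : 1 - p = 1 + -1 * (p%:M : 'M[R]_d) i i by rewrite mxE eqxx mulr1n mulN1r.
apply: (@le_trans _ _ (\int[D]_S (cst 0 S))%E); first by rewrite integral0.
apply: (ae_le_has_mean _ _ m) => //.
apply: ae_imply D_fcr => S fS; rewrite lee_fin mulN1r subr_ge0.
exact: le_trans (ler_norm _) (projS_entry_le fS i i).
Qed.

End MeanProjection.

(** * Integration against an independent pair *)

Section IndependentPair.
Context (d0 d1 d2 : measure_display) (Omega : measurableType d0)
  (T1 : measurableType d1) (T2 : measurableType d2) (R : realType).
Variables (P : probability Omega R) (D : probability T1 R).
Variables (S : Omega -> T1) (X : Omega -> T2).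
Hypotheses (mS : measurable_fun setT S) (mX : measurable_fun setT X).
Hypothesis SX : forall A B, measurable A -> measurable B ->
  P (X @^-1` A `&` S @^-1` B) = (P (X @^-1` A) * D B)%E.

(** Independence identifies the joint law with the product law on rectangles, hence everywhere by
    uniqueness of product measures; Tonelli then splits the integral. *)
Lemma integral_independent_pair (g : T1 * T2 -> \bar R) :
  measurable_fun setT g -> (forall z, 0 <= g z)%E ->
  (\int[P]_w g (S w, X w) = \int[P]_w \int[D]_s g (s, X w))%E.
Proof.
move=> mg g0.
have mSX : measurable_fun setT (fun w => (S w, X w)) by exact: measurable_fun_pair.
pose Xm : {mfun Omega >-> T2} := mfun_Sub (mem_set mX).
pose SXm : {mfun Omega >-> (T1 * T2)%type} := mfun_Sub (mem_set mSX).
have XmE w : Xm w = X w by [].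
have SXmE w : SXm w = (S w, X w) by [].
transitivity (\int[distribution P SXm]_z g z)%E.
  by rewrite ge0_integral_distribution.
transitivity (\int[D \x distribution P Xm]_z g z)%E.
  apply: eq_measure_integral => A mA _; apply/esym.
  apply: product_measure_unique => //= B C mB mC.
  rewrite /distribution /pushforward muleC -SX//.
  by congr (P _); apply/seteqP; split => w [].
rewrite fubini_tonelli2// ge0_integral_distribution//.
- exact: measurable_fun_fubini_tonelli_G.
- by move=> y; apply: integral_ge0.
Qed.

End IndependentPair.

(** * Measurability of the objective and of the model along random points *)

Section ModelMeasurability.
Context (disp : measure_display) (T : measurableType disp) (R : realType).

Definition measurable_mx m n (A : T -> 'M[R]_(m, n)) :=
  forall i j, measurable_fun setT (fun t => A t i j).

Lemma measurable_mulmx m n p (A : T -> 'M[R]_(m, n)) (B : T -> 'M[R]_(n, p)) :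
  measurable_mx A -> measurable_mx B -> measurable_mx (fun t => A t *m B t).
Proof.
move=> mA mB i j; under eq_fun do rewrite mxE.
by apply: measurable_sum => k; apply: measurable_funM.
Qed.

Lemma measurable_addmx m n (A B : T -> 'M[R]_(m, n)) :
  measurable_mx A -> measurable_mx B -> measurable_mx (fun t => A t + B t).
Proof. by move=> mA mB i j; under eq_fun do rewrite mxE; apply: measurable_funD. Qed.

Lemma measurable_dot n (u v : T -> 'cV[R]_n) :
  measurable_mx u -> measurable_mx v -> measurable_fun setT (fun t => dot (u t) (v t)).
Proof.
move=> mu mv; under eq_fun do rewrite dotE.
by apply: measurable_sum => k; apply: measurable_funM.
Qed.

Lemma measurable_enorm n (u : T -> 'cV[R]_n) :
  measurable_mx u -> measurable_fun setT (fun t => enorm (u t)).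
Proof.
move=> mu; have ms : measurable_fun setT (@Num.sqrt R).
  by apply: continuous_measurable_fun; exact: sqrt_continuous.
exact: (measurableT_comp ms (measurable_dot mu mu)).
Qed.

Lemma measurable_entries d (X : T -> borelType 'cV[R]_d) :
  measurable_fun setT X -> measurable_mx (X : T -> 'cV[R]_d).
Proof.
move=> mX i j.
exact: (measurableT_comp (continuous_borel_measurable (@coord_continuous R d 1 i j)) mX).
Qed.

Variables (d : nat) (f : 'cV[R]_d -> R) (psi : 'cV[R]_d -> \bar R) (M : R).
Hypotheses (f_diff3 : three_times_differentiable f) (psi_closed : closed_fun psi).

Lemma measurable_cV_comp (x : T -> 'cV[R]_d) (g : 'cV[R]_d -> R) :
  measurable_mx x -> continuous g -> measurable_fun setT (fun t => g (x t)).
Proof.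
move=> mx cg; apply: (measurableT_comp (continuous_borel_measurable cg)).
by apply: measurable_fun_cV => i.
Qed.

Lemma measurable_objective (x : T -> 'cV[R]_d) :
  measurable_mx x -> measurable_fun setT (fun t => objective f psi (x t)).
Proof.
move=> mx; have [df _ _] := f_diff3.
apply: emeasurable_funD.
  apply/measurable_EFinP; apply: measurable_cV_comp => // z; exact: differentiable_continuous.
apply: (measurableT_comp (closed_fun_measurable psi_closed)).
by apply: measurable_fun_cV => i.
Qed.

Lemma measurable_proj_model (S : T -> borelType (sketch R d)) (x v : T -> 'cV[R]_d) :
  measurable_fun setT S -> measurable_mx x -> measurable_mx v ->
  measurable_fun setT (fun t => proj_model f psi M (S t) (x t) (v t)).
Proof.
move=> mS mx mv; have [df dg dh] := f_diff3.
have mP : measurable_mx (fun t => projS (S t)).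
  by move=> i j; apply: (measurableT_comp (measurable_projS i j)).
have mPv : measurable_mx (fun t => projS (S t) *m v t) by exact: measurable_mulmx.
have mg : measurable_mx (fun t => grad f (x t)).
  move=> i j; apply: (@measurable_cV_comp x (fun z => grad f z i j)) => // z.
  apply: differentiable_continuous.
  exact: (differentiable_comp (dg z) (differentiable_coord _ _ _)).
have mh : measurable_mx (fun t => hess f (x t)).
  move=> i j; apply: (@measurable_cV_comp x (fun z => hess f z i j)) => // z.
  apply: differentiable_continuous.
  exact: (differentiable_comp (dh z) (differentiable_coord _ _ _)).
apply: emeasurable_funD.
  apply/measurable_EFinP; apply: measurable_funD; last first.
    apply: measurable_funM => //; apply: measurable_funX; exact: measurable_enorm.
  apply: measurable_funD; last first.
    apply: measurable_funM => //; apply: measurable_dot => //; exact: measurable_mulmx.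
  apply: measurable_funD; last exact: measurable_dot.
  by apply: measurable_cV_comp => // z; exact: differentiable_continuous.
apply: (measurableT_comp (closed_fun_measurable psi_closed)).
apply: measurable_fun_cV => i.
exact: (measurable_addmx mx mPv).
Qed.

End ModelMeasurability.

(** * Mean of the model over the sketch *)

Section ExpectedModel.
Variables (R : realType) (d : nat) (f : 'cV[R]_d -> R) (psi : 'cV[R]_d -> \bar R).
Variables (M L p Fmin : R).
Hypotheses (hd : (0 < d)%N) (f_diff3 : three_times_differentiable f).
Hypotheses (f_convex : convex_function (E := 'cV[R]_d) setT f).
Hypotheses (f_lip : lipschitz_hessian f M) (psi_closed : closed_fun psi).
Hypothesis f_smooth : forall y, loewner_le (hess f y) L%:M.
Hypothesis Fmin_le : forall y, (Fmin%:E <= objective f psi y)%E.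
Variables (D : probability (borelType (sketch R d)) R).
Hypothesis D_fcr : \forall S \ae D, full_column_rank S.
Variables (RangeD : set (sketch R d)).
Hypotheses (D_range : \forall S \ae D, RangeD S) (p_ge0 : 0 <= p).
Hypothesis D_mean : forall i j : 'I_d,
  ('E_D[fun S : borelType (sketch R d) => projS S i j] = ((p%:M : 'M[R]_d) i j)%:E)%E.
Hypothesis psi_sep : separable_fun (RangeD `&` @full_column_rank R d) psi.

Lemma smooth_ge0 : 0 <= L.
Proof.
pose e : 'cV[R]_d := delta_mx (Ordinal hd) 0.
have := le_trans (hess_psd f_diff3 0 e f_lip f_convex) (loewner_le_scalar e (f_smooth 0)).
by rewrite -sqr_enorm enorm_delta expr1n mulr1.
Qed.

Lemma proj_model_ge S x v : (0 <= proj_model f psi M S x v - Fmin%:E)%E.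
Proof.
rewrite sube_ge0// ; apply: le_trans (Fmin_le _) _.
exact: objective_le_proj_model.
Qed.

(** A pointwise bound affine in the projection is averaged, which produces the quadratic model at
    [p *: v]; Taylor and convexity of f between [x] and [x + v] then bring back function values. *)
Lemma integral_proj_model_le x v (a b : R) :
  psi x = a%:E -> psi (x + v)%R = b%:E ->
  (\int[D]_S (proj_model f psi M S x v - Fmin%:E) <=
    ((1 - p) * (f x + a) + p * (f (x + v) + b) + L * (p * (1 - p) / 2) * enorm v ^+ 2
     + M * (p / 3) * enorm v ^+ 3 - Fmin)%:E)%E.
Proof.
move=> xa vb; have M0 := lipschitz_ge0 f_lip hd.
have [|| w wE PwE] := separable_projS psi_sep (x := x) (v := v).
- by rewrite /edom /= xa ltry.
- by rewrite /edom /= vb ltry.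
have p1 : p <= 1 := mean_le1 D_fcr D_mean hd.
pose e : 'cV[R]_d := const_mx 1.
have we : dot w e = b - a.
  by move: wE; rewrite xa vb -EFinD => -[->]; rewrite addrC addKr.
pose H := hess f x.
(* The pointwise bound is [c + dot (projS S *m v) bv + dot (projS S *m w) e]: smooth and cubic parts
   in [bv], the change of psi in the last term. *)
pose bv := grad f x + 2^-1 *: (p *: (H *m v + H^T *m v) + (L * (1 - 2 * p)) *: v)
  + (M / 6 * enorm v) *: v.
pose c := f x + a - p ^+ 2 * dot (H *m v) v / 2 + L * p ^+ 2 * dot v v / 2 - Fmin.
have m := has_meanD (has_mean_cst D c)
  (has_meanD (has_mean_dot_projS D_fcr D_mean v bv) (has_mean_dot_projS D_fcr D_mean w e)).
have HvT : dot v (H^T *m v) = dot (H *m v) v by rewrite dot_mulmx.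
have Hv : dot v (H *m v) = dot (H *m v) v by rewrite dotC.
apply: le_trans (ae_le_has_mean _ _ m _) _.
- apply: emeasurable_funB => //; apply: measurable_proj_model => //.
- by move=> S; exact: proj_model_ge.
- apply: (ae_imply2 _ D_fcr D_range) => S fS RS.
  rewrite /proj_model PwE// xa -!EFinD lee_fin -/e /quad -/H /c /bv.
  have := dot_hess_projS_le v p fS (f_smooth x); rewrite -/H.
  have := enorm_projS_le fS v; have := sqr_enorm (projS S *m v); rewrite (dot_projS fS).
  have := dot_ge0 (projS S *m v); rewrite (dot_projS fS).
  rewrite !(dotDr, dotZr) (dotC (grad f x)).
  set g := dot (projS S *m v) (grad f x); set g2 := dot (projS S *m v) (H *m v).
  set g3 := dot (projS S *m v) (H^T *m v); set n := enorm (projS S *m v).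
  set g4 := dot (projS S *m v) v; set g5 := dot (projS S *m w) e.
  move=> g40 nn nv hh.
  (* From |Pv|^2 = <Pv, v> and |Pv| <= |v|. *)
  have : M / 6 * n ^+ 3 <= M / 6 * enorm v * g4.
    rewrite (exprS _ 2) nn -[leRHS]mulrA ler_wpM2l ?divr_ge0// ler_wpM2r//.
  lra.
rewrite lee_fin we /c /bv !(dotDr, dotZr) HvT Hv (dotC v (grad f x)).
(* The averaged quadratic terms are those of the model at [p *: v]; returning to f there costs a
   second cubic term with factor [M / 6]. *)
have := quad_le_f f_diff3 f_lip x (p *: v).
rewrite /quad -scalemxAr !(dotZl, dotZr) enormZ ger0_norm// -/H.
have := convex_segment_le (x + v) x f_convex (a := p).
rewrite p_ge0 p1 => /(_ isT).
have -> : p *: (x + v) + (1 - p) *: x = x + p *: v.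
  by rewrite scalerDr scalerBl scale1r addrC addrA subrK.
rewrite exprMn -!sqr_enorm => h1 h2.
(* With p^3 <= p the two cubic terms add up to [M * (p / 3) * enorm v ^+ 3]. *)
have h3 : M / 6 * (p ^+ 3 * enorm v ^+ 3) <= M / 6 * (p * enorm v ^+ 3).
  rewrite ler_wpM2l ?divr_ge0// ler_wpM2r ?exprn_ge0 ?enorm_ge0//.
  by rewrite exprS ler_piMr// exprn_ile1.
lra.
Qed.

End ExpectedModel.

(** * Solving the scalar recursion for the mean gaps *)

Section Recursion.
Variables (R : realType) (p c1 c2 : R) (delta : nat -> R).
Hypotheses (p_gt0 : 0 < p) (c1_ge0 : 0 <= c1) (c2_ge0 : 0 <= c2) (delta0 : 0 <= delta 0%N).
Hypothesis delta_step : forall k (alpha : R), 0 <= alpha <= 1 ->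
  delta k.+1 <= (1 - alpha * p) * delta k + c1 * alpha ^+ 2 + c2 * alpha ^+ 3.

(* [4 / (3 p^3) + \sum_(i <= k) i^2]; with q = 1 / p, the constant comes from
   [4 q^3 + k^3 - 3 q k^2 = (k + q) (k - 2 q)^2 >= 0], which keeps the step
   size [q k^2 / A_k] at most 1. *)
Definition rate_weight (k : nat) : R :=
  4 / 3 * p^-1 ^+ 3 + k%:R * (k%:R + 1) * (2 * k%:R + 1) / 6.

Lemma rate_weight_ge k : 4 / 3 * p^-1 ^+ 3 + k%:R ^+ 3 / 3 <= rate_weight k.
Proof.
rewrite /rate_weight lerD2l; have : 0 <= k%:R :> R by exact: ler0n.
move: (k%:R) => n n0; have := mulr_ge0 n0 n0; lra.
Qed.

Lemma rate_weight_gt0 k : 0 < rate_weight k.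
Proof.
apply: lt_le_trans (rate_weight_ge k).
by rewrite ltr_pwDl ?divr_ge0 ?exprn_ge0 ?ler0n// mulr_gt0// exprn_gt0 ?invr_gt0.
Qed.

Lemma rate_stepsize_le k : p^-1 * k%:R ^+ 2 <= rate_weight k.
Proof.
apply: le_trans (rate_weight_ge k).
have q0 : 0 < p^-1 by rewrite invr_gt0.
have : 0 <= (k%:R + p^-1) * (k%:R - 2 * p^-1) ^+ 2.
  by rewrite mulr_ge0 ?sqr_ge0// addr_ge0 ?ler0n// ltW.
move: (k%:R) (p^-1) => n q; lra.
Qed.

(** Step i adds at most [3 * i] to the factor of [c1 * p^-1 ^+ 2] and 9 to that of [c2 * p^-1 ^+ 3];
    the right side holds the sums of these increments. *)
Lemma rate_invariant k : rate_weight k * delta k <=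
  rate_weight 0 * delta 0%N + c1 * p^-1 ^+ 2 * (3 / 2 * k%:R * (k%:R + 1))
  + c2 * p^-1 ^+ 3 * (9 * k%:R).
Proof.
elim: k => [|k IH]; first by rewrite !mulr0 mul0r !mulr0 !addr0.
have A0 := rate_weight_gt0 k.+1.
have q0 : 0 < p^-1 by rewrite invr_gt0.
pose n : R := k.+1%:R; have n0 : 0 < n by rewrite ltr0n.
(* The step size is chosen so that [A * (1 - al * p)] is the previous weight [A - n ^+ 2]. *)
pose A := rate_weight k.+1; pose al := p^-1 * n ^+ 2 / A.
have al01 : 0 <= al <= 1.
  rewrite divr_ge0 ?mulr_ge0 ?exprn_ge0 ?(ltW n0) ?(ltW q0) ?(ltW A0)//=.
  by rewrite ler_pdivrMr// mul1r rate_stepsize_le.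
have := delta_step k al01; rewrite -(ler_pM2l A0) -/A => /le_trans; apply.
have kn : k%:R = n - 1 :> R by rewrite /n -natr1 addrK.
have EA : A * (1 - al * p) = rate_weight k.
  have -> : A * (1 - al * p) = A - n ^+ 2.
    by rewrite /al; field; rewrite !gt_eqF.
  by rewrite /A /rate_weight -/n kn; field; rewrite gt_eqF.
have nA : n ^+ 3 / 3 <= A.
  apply: le_trans (rate_weight_ge k.+1).
  by rewrite lerDr mulr_ge0// exprn_ge0// ltW.
(* Both error bounds follow from [A >= n ^+ 3 / 3], used once here and squared in [b2]. *)
have b1 : A * al ^+ 2 <= p^-1 ^+ 2 * (3 * n).
  have -> : A * al ^+ 2 = p^-1 ^+ 2 * (n ^+ 4 / A).
    by rewrite /al; field; rewrite !gt_eqF.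
  rewrite ler_wpM2l ?exprn_ge0 ?(ltW q0)// ler_pdivrMr//.
  have := ler_wpM2l (ltW n0) nA; lra.
have b2 : A * al ^+ 3 <= p^-1 ^+ 3 * 9.
  have -> : A * al ^+ 3 = p^-1 ^+ 3 * (n ^+ 3 / A) ^+ 2.
    by rewrite /al; field; rewrite !gt_eqF.
  rewrite ler_wpM2l ?exprn_ge0 ?(ltW q0)//.
  have h0 : 0 <= n ^+ 3 / A by rewrite divr_ge0 ?exprn_ge0 ?(ltW n0) ?(ltW A0).
  have h3 : n ^+ 3 / A <= 3 by rewrite ler_pdivrMr//; lra.
  have := ler_pM h0 h0 h3 h3; rewrite expr2; lra.
have := ler_wpM2l c1_ge0 b1; have := ler_wpM2l c2_ge0 b2.
move: IH; rewrite -EA -/n kn.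
move: (delta k) (rate_weight 0 * _) (p^-1 ^+ 2) (p^-1 ^+ 3) => dk C q2 q3; lra.
Qed.

Lemma rate_bound k : (1 <= k)%N ->
  delta k <= c1 * p^-1 ^+ 2 * (9 / k%:R) + c2 * p^-1 ^+ 3 * (27 / k%:R ^+ 2)
    + delta 0%N / (1 + 4^-1 * (p * k%:R) ^+ 3).
Proof.
move=> k1; have := rate_invariant k; have A0 := rate_weight_gt0 k.
have AE := rate_weight_ge k.
have n1 : 1 <= k%:R :> R by rewrite ler1n.
move: (rate_weight k) A0 AE => A A0 AE; move: (k%:R) n1 AE => n n1 AE H.
have n0 : 0 < n by lra.
have q0 : 0 < p^-1 by rewrite invr_gt0.
have nA : n ^+ 3 / 3 <= A.
  by apply: le_trans AE; rewrite lerDr mulr_ge0// exprn_ge0// ltW.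
rewrite -(ler_pM2l A0); apply: le_trans H _.
(* For n >= 1 the left side is at most 3 n^2, and [A >= n ^+ 3 / 3] makes the right side at least 3
   n^2. *)
have h1 : 3 / 2 * n * (n + 1) <= A * (9 / n).
  rewrite mulrA ler_pdivlMr//.
  have h : 0 <= n * n * (n - 1) by rewrite !mulr_ge0 ?subr_ge0// ltW.
  lra.
have h2 : 9 * n <= A * (27 / n ^+ 2).
  rewrite mulrA ler_pdivlMr ?exprn_gt0//; lra.
(* The initial weight times [1 + 4^-1 * (p * n) ^+ 3] is exactly the lower bound [AE] for [A]. *)
have h3 : rate_weight 0 * delta 0%N <= A * (delta 0%N / (1 + 4^-1 * (p * n) ^+ 3)).
  have w0 : rate_weight 0 = 4 / 3 * p^-1 ^+ 3 by rewrite /rate_weight !mul0r addr0.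
  have d0 : 0 < 1 + 4^-1 * (p * n) ^+ 3.
    by rewrite ltr_pwDl// mulr_ge0// exprn_ge0// mulr_ge0// ltW.
  rewrite [leRHS]mulrCA [leRHS]mulrC [leLHS]mulrC.
  rewrite [leRHS]mulrC ler_wpM2l// ler_pdivlMr// w0.
  apply: le_trans AE; rewrite le_eqVlt; apply/orP; left; apply/eqP.
  by field; rewrite gt_eqF.
have e1 : 0 <= c1 * p^-1 ^+ 2 by rewrite mulr_ge0// exprn_ge0// ltW.
have e2 : 0 <= c2 * p^-1 ^+ 3 by rewrite mulr_ge0// exprn_ge0// ltW.
have := ler_wpM2l e1 h1; have := ler_wpM2l e2 h2; lra.
Qed.

End Recursion.

(** * Recursion and rate for the mean gaps of the iterates *)

Section ExpectedStep.
Variables (R : realType) (d : nat) (f : 'cV[R]_d -> R) (psi : 'cV[R]_d -> \bar R).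
Variables (M L p Fmin : R) (xs : 'cV[R]_d).
Hypotheses (hd : (0 < d)%N) (f_diff3 : three_times_differentiable f).
Hypotheses (f_convex : convex_function (E := 'cV[R]_d) setT f).
Hypotheses (f_lip : lipschitz_hessian f M) (psi_closed : closed_fun psi).
Hypotheses (psi_convex : econvex psi) (psi_gtNy : forall y, (-oo < psi y)%E).
Hypothesis f_smooth : forall y, loewner_le (hess f y) L%:M.
Hypothesis xsE : objective f psi xs = Fmin%:E.
Hypothesis Fmin_le : forall y, (Fmin%:E <= objective f psi y)%E.
Variables (D : probability (borelType (sketch R d)) R).
Hypothesis D_fcr : \forall S \ae D, full_column_rank S.
Variables (RangeD : set (sketch R d)).
Hypotheses (D_range : \forall S \ae D, RangeD S) (p_ge0 : 0 <= p).
Hypothesis D_mean : forall i j : 'I_d,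
  ('E_D[fun S : borelType (sketch R d) => projS S i j] = ((p%:M : 'M[R]_d) i j)%:E)%E.
Hypothesis psi_sep : separable_fun (RangeD `&` @full_column_rank R d) psi.

Lemma objective_fin x F : objective f psi x = F%:E -> psi x = (F - f x)%:E.
Proof.
rewrite /objective; have := psi_gtNy x.
by case: (psi x) => // r _ [<-]; rewrite addrAC subrr add0r.
Qed.

Definition step_error (rho al : R) : R :=
  L * (p * (1 - p) / 2) * rho ^+ 2 * al ^+ 2 + M * (p / 3) * rho ^+ 3 * al ^+ 3.

Lemma step_error_ge0 rho al : 0 <= rho -> 0 <= al -> 0 <= step_error rho al.
Proof.
move=> r0 a0; have p1 : p <= 1 := mean_le1 D_fcr D_mean hd.
have L0 := smooth_ge0 hd f_diff3 f_convex f_lip f_smooth.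
have M0 := lipschitz_ge0 f_lip hd.
by rewrite addr_ge0// !mulr_ge0 ?exprn_ge0 ?invr_ge0 ?subr_ge0.
Qed.

(** Convexity of f and psi on the segment towards [xs] turns the averaged model at [al *: (xs - x)]
    into a contraction of the gap by [1 - al * p]; [rho] bounds the length of the segment. *)
Lemma integral_proj_model_segment x (F rho al : R) :
  objective f psi x = F%:E -> enorm (x - xs) <= rho -> 0 <= al <= 1 ->
  (\int[D]_S (proj_model f psi M S x (al *: (xs - x)) - Fmin%:E) <=
    ((1 - al * p) * (F - Fmin) + step_error rho al)%:E)%E.
Proof.
move=> xF xrho al01; have /andP[a0 a1] := al01.
have p1 : p <= 1 := mean_le1 D_fcr D_mean hd.
have L0 := smooth_ge0 hd f_diff3 f_convex f_lip f_smooth.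
have M0 := lipschitz_ge0 f_lip hd.
have px := objective_fin xF; have pxs := objective_fin xsE.
have yE : x + al *: (xs - x) = al *: xs + (1 - al) *: x.
  by rewrite scalerBr scalerBl scale1r addrCA addrA addrAC.
have py := psi_convex xs x al01; rewrite px pxs -!EFinM -EFinD -yE in py.
(* Psi is finite at the segment point: convexity bounds it above and properness excludes [-oo]. *)
have [b yb bx] : exists2 b, psi (x + al *: (xs - x)) = b%:E &
    b <= al * (Fmin - f xs) + (1 - al) * (F - f x).
  move: py (psi_gtNy (x + al *: (xs - x))).
  by case: (psi _) => // b; rewrite lee_fin => h _; exists b.
apply: le_trans (integral_proj_model_le hd f_diff3 f_convex f_lip psi_closed
  f_smooth Fmin_le D_fcr D_range p_ge0 D_mean psi_sep px yb) _.
rewrite lee_fin enormZ ger0_norm// !exprMn.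
have ec : enorm (xs - x) <= rho by rewrite -enormN opprB.
have e0 := enorm_ge0 (xs - x).
have := convex_segment_le xs x f_convex al01; rewrite -yE => fy.
have h2 : al ^+ 2 * enorm (xs - x) ^+ 2 <= al ^+ 2 * rho ^+ 2.
  by rewrite ler_wpM2l ?exprn_ge0// ler_pXn2r ?nnegrE// (le_trans e0).
have h3 : al ^+ 3 * enorm (xs - x) ^+ 3 <= al ^+ 3 * rho ^+ 3.
  by rewrite ler_wpM2l ?exprn_ge0// ler_pXn2r ?nnegrE// (le_trans e0).
have k2 : 0 <= L * (p * (1 - p) / 2) by rewrite !mulr_ge0 ?subr_ge0 ?invr_ge0.
have k3 : 0 <= M * (p / 3) by rewrite !mulr_ge0 ?invr_ge0.
have := ler_wpM2l k2 h2; have := ler_wpM2l k3 h3.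
have := ler_wpM2l p_ge0 (lerD bx fy).
rewrite /step_error; lra.
Qed.

Variables (disp : measure_display) (Omega : measurableType disp).
Variables (P : probability Omega R) (S : nat -> Omega -> borelType (sketch R d)).
Variables (x : nat -> Omega -> borelType 'cV[R]_d) (x0 : 'cV[R]_d) (F0 rho : R).
Hypothesis x_sscn : sscn f psi P D S x x0.
Hypotheses (x0E : objective f psi x0 = F0%:E) (rho_ge0 : 0 <= rho).
Hypothesis rhoP : forall y, (objective f psi y <= F0%:E)%E -> enorm (y - xs) <= rho.

Lemma sscn_level k : \forall w \ae P, (objective f psi (x k w) <= F0%:E)%E.
Proof.
have [_ xx0 _ _ st] := x_sscn.
elim: k => [|k IH].
  by apply: aeW => w; rewrite xx0 x0E.
apply: (ae_imply2 _ IH (st k)) => w h1 h2; apply: le_trans h1.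
exact: (sscn_step_decr f_diff3 f_lip h2).
Qed.

Lemma measurable_iterate k : measurable_mx (x k).
Proof.
have [[_ mx] _ _ _ _] := x_sscn; exact: measurable_entries.
Qed.

(** Subtracting the minimum inside the integral makes the integrand nonnegative, so monotonicity and
    Tonelli apply before integrability is known. *)
Definition mean_gap k : \bar R := \int[P]_w (objective f psi (x k w) - Fmin%:E)%E.

Lemma gap_ge0 y : (0 <= objective f psi y - Fmin%:E)%E.
Proof. by rewrite sube_ge0. Qed.

Lemma measurable_gap k : measurable_fun setT (fun w => objective f psi (x k w) - Fmin%:E)%E.
Proof.
apply: emeasurable_funB => //; apply: measurable_objective => //.
exact: measurable_iterate.
Qed.

(** The model depends only on the fresh sketch and the current iterate, so its mean can be taken
    over the sketch first, with the iterate frozen. *)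
Lemma mean_gap_step k al : 0 <= al <= 1 ->
  (mean_gap k.+1 <= (1 - al * p)%:E * mean_gap k + (step_error rho al)%:E)%E.
Proof.
move=> al01; have /andP[a0 a1] := al01.
have [[mS mx] xx0 SD ind st] := x_sscn.
have p1 : p <= 1 := mean_le1 D_fcr D_mean hd.
have mxk := measurable_iterate.
pose g (z : borelType (sketch R d) * borelType 'cV[R]_d) : \bar R :=
  (proj_model f psi M z.1 z.2 (al *: (xs - z.2)) - Fmin%:E)%E.
have mg : measurable_fun setT g.
  have m2 := measurable_entries (@measurable_snd _ _ (borelType (sketch R d)) _).
  apply: emeasurable_funB => //; apply: measurable_proj_model => // i j.
  under eq_fun do rewrite !mxE.
  by apply: measurable_funM => //; apply: measurable_funB => //; exact: m2.
have g0 z : (0 <= g z)%E by exact: proj_model_ge.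
apply: (@le_trans _ _ (\int[P]_w g (S k w, x k w))%E).
  apply: ae_ge0_le_integral => //.
  - by move=> w _; exact: gap_ge0.
  - exact: measurable_gap.
  - by apply: (measurableT_comp mg); apply: measurable_fun_pair.
  - apply: ae_imply (st k) => w stw _; rewrite leeB//.
    exact: (sscn_step_le_proj_model f_diff3 f_lip _ stw).
rewrite (@integral_independent_pair _ _ _ _ _ _ _ P D (S k) (x k))//; last first.
  move=> A B mA mB; rewrite -(SD k)// ind//.
  (* Events of the iterate [x k] alone are among the generators of [past]. *)
  apply: sub_sigma_algebra; right; exists k => //=.
  by exists A => //; rewrite setTI.
have s0 := step_error_ge0 rho_ge0 a0.
have ap : 0 <= 1 - al * p by rewrite subr_ge0 mulr_ile1.
apply: (@le_trans _ _ (\int[P]_w ((1 - al * p)%:E * (objective f psi (x k w) - Fmin%:E)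
    + (step_error rho al)%:E))%E); last first.
  rewrite ge0_integralD//.
  - rewrite ge0_integralZl_EFin//; last 2 first.
    + by move=> w _; exact: gap_ge0.
    + exact: measurable_gap.
    by rewrite integral_cst//= probability_setT mule1.
  - by move=> w _; rewrite mule_ge0 ?gap_ge0.
  - by apply: measurable_funeM; exact: measurable_gap.
apply: ae_ge0_le_integral => //.
- by move=> w _; apply: integral_ge0 => s _; exact: g0.
- exact: (measurableT_comp (measurable_fun_fubini_tonelli_G g mg g0) (mx k)).
- by move=> w _; rewrite adde_ge0 ?mule_ge0 ?gap_ge0 ?lee_fin.
- apply: emeasurable_funD => //; apply: measurable_funeM; exact: measurable_gap.
(* Almost surely the iterate is in the initial level set, where its objective is finite and its
   distance to [xs] is at most [rho]. *)
- apply: ae_imply (sscn_level k) => w lw _.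
  have [F FE] : exists F, objective f psi (x k w) = F%:E.
    move: lw (Fmin_le (x k w)); case: (objective _ _ _) => // F; by exists F.
  rewrite FE -EFinB -EFinM -EFinD.
  exact: (integral_proj_model_segment FE (rhoP lw) al01).
Qed.

Lemma mean_gap_fin k : exists2 r : R, 0 <= r & mean_gap k = r%:E.
Proof.
have h0 : (0 <= mean_gap k)%E by apply: integral_ge0 => w _; exact: gap_ge0.
have : (mean_gap k <= (F0 - Fmin)%:E)%E.
  apply: le_trans (_ : (\int[P]_w (cst (F0 - Fmin)%:E w) <= _)%E).
    apply: ae_ge0_le_integral => //.
    - by move=> w _; exact: gap_ge0.
    - exact: measurable_gap.
    - move=> w _; rewrite /= EFinB -x0E; exact: gap_ge0.
    - by apply: ae_imply (sscn_level k) => w lw _; rewrite /= EFinB leeD2r.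
  by rewrite integral_cst//= probability_setT mule1.
by move: h0; case: (mean_gap k) => // r r0 _; exists r.
Qed.

Lemma mean_gap0 : mean_gap 0 = (F0 - Fmin)%:E.
Proof.
have [_ xx0 _ _ _] := x_sscn.
rewrite /mean_gap; under eq_integral do rewrite xx0 x0E -EFinB.
by rewrite integral_cst//= probability_setT mule1.
Qed.

(** Finiteness of the mean gap makes the gap integrable, which allows the constant to be split
    off. *)
Lemma mean_objective k : (\int[P]_w objective f psi (x k w) = mean_gap k + Fmin%:E)%E.
Proof.
have [r _ rE] := mean_gap_fin k.
have ig : P.-integrable setT (fun w => objective f psi (x k w) - Fmin%:E)%E.
  apply/integrableP; split; first exact: measurable_gap.
  under eq_integral do rewrite gee0_abs ?gap_ge0//.
  by rewrite -/(mean_gap k) rE ltry.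
transitivity (\int[P]_w ((objective f psi (x k w) - Fmin%:E) + cst Fmin%:E w))%E.
  by apply: eq_integral => w _; rewrite /cst subeK.
rewrite integralD//; last exact: finite_measure_integrable_cst.
by rewrite integral_cst//= probability_setT mule1.
Qed.

Lemma sscn_rate k : 0 < p -> (1 <= k)%N ->
  (mean_gap k <= ((1 - p) / p * ((9 / 2) * L * rho ^+ 2 / k%:R)
     + p^-1 ^+ 2 * (9 * M * rho ^+ 3 / k%:R ^+ 2)
     + (F0 - Fmin) / (1 + 4^-1 * (p * k%:R) ^+ 3))%:E)%E.
Proof.
move=> p0 k1.
have /choice[del delP] : forall k, exists r : R, 0 <= r /\ mean_gap k = r%:E.
  by move=> n; have [r r0 rE] := mean_gap_fin n; exists r.
have p1 : p <= 1 := mean_le1 D_fcr D_mean hd.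
have L0 := smooth_ge0 hd f_diff3 f_convex f_lip f_smooth.
have M0 := lipschitz_ge0 f_lip hd.
have k2 : 0 <= L * (p * (1 - p) / 2) * rho ^+ 2.
  by rewrite !mulr_ge0 ?exprn_ge0 ?subr_ge0 ?invr_ge0.
have k3 : 0 <= M * (p / 3) * rho ^+ 3 by rewrite !mulr_ge0 ?exprn_ge0 ?invr_ge0.
have [d0 _] := delP 0%N.
have stp n (al : R) : 0 <= al <= 1 -> del n.+1 <= (1 - al * p) * del n +
    L * (p * (1 - p) / 2) * rho ^+ 2 * al ^+ 2 + M * (p / 3) * rho ^+ 3 * al ^+ 3.
  move=> al01; have := mean_gap_step n al01.
  by rewrite (delP n).2 (delP n.+1).2 -EFinM -EFinD lee_fin /step_error addrA.
have := rate_bound p0 k2 k3 d0 stp k1.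
have -> : del 0%N = F0 - Fmin.
  by have := (delP 0%N).2; rewrite mean_gap0 => -[].
rewrite (delP k).2 lee_fin => /le_trans; apply.
rewrite le_eqVlt; apply/orP; left; apply/eqP.
have kn : k%:R != 0 :> R by rewrite pnatr_eq0 -lt0n.
congr (_ + _ + _); field; rewrite ?kn ?gt_eqF//.
Qed.

End ExpectedStep.

(** * The rate for the extended-valued objective *)

Theorem theorem5p8 (R : realType) (d : nat) (hd : (0 < d)%N)
  (f : 'cV[R]_d -> R) (psi : 'cV[R]_d -> \bar R) (M L tau : R)
  (f_convex : convex_function (E := 'cV[R]_d) setT f)
  (f_diff3 : three_times_differentiable f)
  (f_lip : lipschitz_hessian f M)
  (psi_proper : proper_fun psi) (psi_closed : closed_fun psi)
  (psi_convex : econvex psi)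
  (xs : 'cV[R]_d)
  (xs_min : forall y, (objective f psi xs <= objective f psi y)%E)
  (f_smooth : forall y, loewner_le (hess f y) L%:M)
  (D : probability (borelType (sketch R d)) R)
  (D_fcr : \forall S \ae D, full_column_rank S)
  (* the values of D: any set in which S ~ D lies almost surely *)
  (RangeD : set (sketch R d)) (D_range : \forall S \ae D, RangeD S)
  (tau_gt0 : 0 < tau)
  (D_mean : forall i j : 'I_d,
     ('E_D[fun S : borelType (sketch R d) => projS S i j]
       = (((tau / d%:R)%:M : 'M[R]_d) i j)%:E)%E)
  (psi_sep : separable_fun (RangeD `&` @full_column_rank R d) psi)
  (disp : measure_display) (Omega : measurableType disp)
  (P : probability Omega R)
  (S : nat -> Omega -> borelType (sketch R d))
  (x : nat -> Omega -> borelType 'cV[R]_d) (x0 : 'cV[R]_d)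
  (x_sscn : sscn f psi P D S x x0)
  (Rad : \bar R) (Rad_def : Rad = level_radius (objective f psi) xs x0)
  (Rad_fin : (Rad < +oo)%E)
  (k : nat) (hk : (1 <= k)%N) :
  (\int[P]_w objective f psi (x k w) - objective f psi xs <=
    ((d%:R - tau) / tau * ((9 / 2) * L * fine Rad ^+ 2 / k%:R)
     + (d%:R / tau) ^+ 2 * (9 * M * fine Rad ^+ 3 / k%:R ^+ 2))%:E
    + (objective f psi x0 - objective f psi xs)
      * ((1 + 4^-1 * (tau / d%:R * k%:R) ^+ 3)^-1)%:E)%E.
Proof.
have [psi_gtNy [z0 z0dom]] := psi_proper.
have objNy y : (-oo < objective f psi y)%E.
  by rewrite /objective; have := psi_gtNy y; case: (psi y) => // r _; rewrite -EFinD ltNyr.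
(* The minimum is finite by comparison with a point of the domain of psi. *)
have [Fmin xsE] : exists Fmin, objective f psi xs = Fmin%:E.
  have := xs_min z0; have := objNy xs.
  have : (objective f psi z0 < +oo)%E.
    rewrite /objective; move: z0dom; rewrite /edom /=.
    by case: (psi z0) => // r _; rewrite -EFinD ltry.
  case: (objective f psi xs) => //=; first by move=> Fmin; exists Fmin.
  by move=> h _; rewrite leye_eq => /eqP h'; rewrite h' in h.
have Fmin_le y : (Fmin%:E <= objective f psi y)%E by rewrite -xsE.
have d0 : 0 < d%:R :> R by rewrite ltr0n.
pose p := tau / d%:R; have p0 : 0 < p by rewrite divr_gt0.
have c0 : 0 < (1 + 4^-1 * (tau / d%:R * k%:R) ^+ 3)^-1.
  by rewrite invr_gt0 ltr_pwDl// mulr_ge0// exprn_ge0// mulr_ge0// ltW.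
have [x0y|[F0 x0E]] : objective f psi x0 = +oo%E \/ exists F0, objective f psi x0 = F0%:E.
- by move: (objNy x0); case: (objective f psi x0) => // [F0 _|]; [right; exists F0|left].
(* For an infinite initial value the right side is [+oo], the factor of the initial gap being
   positive. *)
- by rewrite x0y xsE addye// gt0_mulye ?lte_fin// addey// leey.
have RadP y : (objective f psi y <= F0%:E)%E -> ((enorm (y - xs))%:E <= Rad)%E.
  by move=> yF; rewrite Rad_def; apply: ereal_sup_ubound; exists y => //=; rewrite x0E.
(* The level set contains [x0], so the supremum is not [-oo] and the radius is a nonnegative
   real. *)
have [rho RadE rho0] : exists2 rho, Rad = rho%:E & 0 <= rho.
  have : ((enorm (x0 - xs))%:E <= Rad)%E by apply: RadP; rewrite x0E.
  case: Rad Rad_fin {Rad_def RadP} => // rho _; rewrite lee_fin => h.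
  by exists rho => //; apply: le_trans h; exact: enorm_ge0.
have rhoP y : (objective f psi y <= F0%:E)%E -> enorm (y - xs) <= rho.
  by move=> /RadP; rewrite RadE lee_fin.
rewrite (mean_objective f_diff3 f_lip psi_closed Fmin_le x_sscn x0E).
rewrite xsE x0E RadE /= addeK//.
apply: le_trans (sscn_rate hd f_diff3 f_convex f_lip psi_closed psi_convex psi_gtNy
  f_smooth xsE Fmin_le D_fcr D_range (ltW p0) D_mean psi_sep x_sscn x0E rho0 rhoP p0 hk) _.
rewrite -EFinB -EFinM -EFinD lee_fin.
have -> : (1 - p) / p = (d%:R - tau) / tau by rewrite /p; field; rewrite !gt_eqF.
by have -> : p^-1 = d%:R / tau by rewrite /p invf_div.
Qed.
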